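(* Let $k$ be a field, let $S=k[x_1,\ldots,x_n]$, let $\Delta$ be a pure simplicial complex on $[n]=\{1,\ldots,n\}$ with $\dim\Delta=1$, and let $I=I_\Delta\subset S$ be its Stanley-Reisner ideal. Then the following conditions are equivalent: (a) $S/I^2$ is clean. (b) $S/I^2$ is Cohen-Macaulay. (c) $\Delta$ is a path of length $1$ or $2$, or a cycle of length $3$, $4$ or $5$. Here $I^2$ is the ordinary square of $I$.
   Context: A simplicial complex $\Delta$ on $[n]$ is a collection of subsets of $[n]$ (called faces) closed under taking subsets; its maximal faces under inclusion are called facets. The dimension of a face $F$ is $|F|-1$, and $\dim\Delta$ is the maximum of the dimensions of its facets. $\Delta$ is pure if all its facets have the same dimension. The Stanley-Reisner ideal of $\Delta$ is $I_\Delta=(\prod_{i\in F}x_i : F\subseteq[n],\ F\notin\Delta)\subset S$. A 1-dimensional complex $\Delta$ is a cycle of length $\ell$ if there are distinct vertices $v_1,\ldots,v_\ell$ such that the facets of $\Delta$ are exactly $\{v_1,v_\ell\}$ and $\{v_i,v_{i+1}\}$ for $i=1,\ldots,\ell-1$. It is a path of length $\ell$ if there are distinct vertices $v_1,\ldots,v_{\ell+1}$ such that the facets of $\Delta$ are exactly $\{v_i,v_{i+1}\}$ for $i=1,\ldots,\ell$. For a monomial ideal $I\subset S$, a prime filtration of $S/I$ is a chain of monomial ideals $\mathcal F: I=I_0\subset I_1\subset\cdots\subset I_r=S$ such that for each $i=1,\ldots,r$ there is a monomial prime ideal $\mathfrak p_i$ of $S$ with $I_i/I_{i-1}\cong S/\mathfrak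 p_i$. Put $\operatorname{Supp}\mathcal F=\{\mathfrak p_1,\ldots,\mathfrak p_r\}$. The filtration is clean if $\operatorname{Supp}\mathcal F$ equals the set $\operatorname{Min} I$ of minimal primes of $I$. $S/I$ is called clean if it admits a clean prime filtration. *)

(* Defs.v *)
From HB Require Import structures.
From mathcomp Require Import all_boot all_order all_algebra.
From mathcomp Require Import boolp classical_sets.
From mathcomp Require Import mpoly.

Set Implicit Arguments.
Unset Strict Implicit.
Unset Printing Implicit Defensive.

Import GRing.Theory.
Local Open Scope ring_scope.
Local Open Scope classical_set_scope.

(* Ideals are Prop-valued sets (MathComp's [idealr] is restricted to decidable
   proper ideals, while the whole ring has to be allowed here). *)
Section Ideals.
Variable R : comNzRingType.
Implicit Types (A B C D G I J m : set R) (s : seq R).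

Definition is_ideal I : Prop :=
  I 0 /\ forall a u v, I u -> I v -> I (a * u + v).

Definition prime_ideal (P : set R) : Prop :=
  [/\ is_ideal P, ~ P 1 & forall u v, P (u * v) -> P u \/ P v].

Definition ideal_gen G : set R :=
  [set p | exists2 s : seq (R * R), (forall x, x \in s -> G x.2)
             & p = \sum_(x <- s) x.1 * x.2].

Definition ideal_mul I J : set R := ideal_gen [set u * v | u in I & v in J].

Definition minimal_primes I : set (set R) :=
  [set P | [/\ prime_ideal P, I `<=` P
             & forall Q, prime_ideal Q -> I `<=` Q -> Q `<=` P -> Q = P]].

(* A / B and C / D are isomorphic R-modules, for ideals B `<=` A and D `<=` C:
   the isomorphism is given by a lift [f] of it to representatives.  The third
   clause is injectivity and, together with the second one, independence of
   the representative. *)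
Definition quotient_iso A B C D : Prop :=
  exists f : R -> R,
    [/\ forall a, A a -> C (f a),
        forall r a b, A a -> A b -> D (f (r * a + b) - (r * f a + f b)),
        forall a, A a -> (D (f a) <-> B a)
      & forall c, C c -> exists2 a, A a & D (c - f a)].

(* Primes of R / J are identified with the primes of R containing J. *)
Definition prime_chain J (d : nat) (P : nat -> set R) : Prop :=
  (forall i, (i <= d)%N -> prime_ideal (P i) /\ J `<=` P i) /\
  (forall i, (i < d)%N -> P i `<` P i.+1).

Definition krull_dim_quo J (d : nat) : Prop :=
  (exists P, prime_chain J d P) /\
  (forall e P, prime_chain J e P -> (e <= d)%N).

Definition ideal_adjoin J s : set R := ideal_gen (J `|` [set` s]).

Definition regular_seq_quo J s : Prop :=
  (forall i, (i < size s)%N -> forall g,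
     ideal_adjoin J (take i s) (s`_i * g) -> ideal_adjoin J (take i s) g) /\
  ~ ideal_adjoin J s 1.

(* The depth of R / J with respect to m is d. *)
Definition depth_quo m J (d : nat) : Prop :=
  (exists s, [/\ forall x, x \in s -> m x, regular_seq_quo J s & size s = d]) /\
  (forall s, (forall x, x \in s -> m x) -> regular_seq_quo J s ->
     (size s <= d)%N).

End Ideals.

Section MonomialIdeals.
Variables (k : fieldType) (n : nat).
Local Notation S := {mpoly k[n]}.
Implicit Types (I J : set S) (F P : nat -> set S).

Definition monomial_ideal I : Prop :=
  exists G : set 'X_{1..n}, I = ideal_gen [set ('X_[m] : S) | m in G].

(* [P i] is the prime of the step from [F i] to [F i.+1]. *)
Definition prime_filtration I (r : nat) F P : Prop :=
  [/\ F 0 = I, F r = [set: S],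
      forall i, (i <= r)%N -> monomial_ideal (F i)
    & forall i, (i < r)%N ->
        [/\ F i `<=` F i.+1, monomial_ideal (P i), prime_ideal (P i)
          & quotient_iso (F i.+1) (F i) [set: S] (P i)]].

Definition filtration_supp (r : nat) P : set (set S) := [set P i | i in `I_r].

Definition clean_quo I : Prop :=
  exists r F P,
    prime_filtration I r F P /\ filtration_supp r P = minimal_primes I.

Definition graded_max_ideal : set S := ideal_gen [set ('X_i : S) | i in setT].

(* Cohen-Macaulayness of S / J as a graded module (J homogeneous): the depth,
   taken with respect to the graded maximal ideal, equals the dimension. *)
Definition cohen_macaulay_quo J : Prop :=
  exists d, depth_quo graded_max_ideal J d /\ krull_dim_quo J d.

End MonomialIdeals.

Section Complexes.
Variable n : nat.
Implicit Types (Delta : {set {set 'I_n}}) (F G : {set 'I_n}).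

(* The singletons are not required to be faces. *)
Definition simplicial_complex Delta : Prop :=
  forall F G, F \in Delta -> G \subset F -> G \in Delta.

Definition facets Delta : {set {set 'I_n}} :=
  [set F : {set 'I_n} | maxset (mem Delta) F]%SET.

Definition face_dim F : int := #|F|%:Z - 1.

Definition complex_dim Delta : int :=
  (\max_(F in facets Delta) #|F|)%N%:Z - 1.

Definition pure Delta : Prop :=
  forall F G, F \in facets Delta -> G \in facets Delta ->
    face_dim F = face_dim G.

(* The vertices v_1, ..., v_l of the usual notation are v 0, ..., v l.-1. *)
Definition is_cycle (l : nat) Delta : Prop :=
  exists2 v : nat -> 'I_n,
    (forall i j, (i < l)%N -> (j < l)%N -> v i = v j -> i = j)
    & facets Delta =
        ([set v 0%N; v l.-1] |: [set [set v i; v i.+1] | i : 'I_l.-1])%SET.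

(* [l] is the number of edges; the vertices are v 0, ..., v l. *)
Definition is_path (l : nat) Delta : Prop :=
  exists2 v : nat -> 'I_n,
    (forall i j, (i <= l)%N -> (j <= l)%N -> v i = v j -> i = j)
    & facets Delta = [set [set v i; v i.+1] | i : 'I_l]%SET.

Definition stanley_reisner (k : fieldType) Delta : set {mpoly k[n]} :=
  ideal_gen [set \prod_(i in F) ('X_i : {mpoly k[n]}) | F in
               [set F : {set 'I_n} | F \notin Delta]].

End Complexes.

Arguments stanley_reisner {n} k Delta _.

(* Main.v *)
From HB Require Import structures.
Require Import Defs.
From mathcomp Require Import all_boot all_order all_algebra.
From mathcomp Require Import boolp classical_sets.
From mathcomp Require Import mpoly.
From mathcomp Require Import zify ring.

(* Membership in I^2 is decided on monomials, and the minimal primes of I^2 are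
   the primes P_F generated by the variables outside a facet F.

   (a) => (b): x_1 + ... + x_n, sum_{i<j} x_i x_j is a regular sequence on every
   S/P_F, hence on S/I^2 by induction along a clean filtration.  Both dim and
   depth are at most 2: there are O(K^2) monomials of degree < K outside I^2, so
   any three polynomials satisfy a nontrivial relation modulo I^2; its lowest
   term contradicts a chain of four primes or a regular sequence of length 3.

   (b) => (c): if the maximal ideal contains a regular sequence of length 2,
   sections of S/I^2 over the punctured spectrum extend (koszul1_vanish).
   Applied to monomials, this puts every squarefree monomial of degree 4 in I^2,
   so that no vertex has three neighbours, and makes the edges meeting {i, j}
   connected, so that any two vertices are at distance at most 2.  The graphs
   with these two properties are those of (c).

   (c) => (a): the monomials outside I^2 are partitioned into translates
   u k[x_a, x_b], {a, b} a facet, listed in such an order that each initial union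
   is closed under divisors; this is a clean filtration.  The lists for the
   vertices of Delta are checked by computation, and each variable y in I
   contributes y times such a partition for S/I. *)

Set Implicit Arguments.
Unset Strict Implicit.
Unset Printing Implicit Defensive.

Import GRing.Theory.
Local Open Scope ring_scope.

(** * Ideals and regular sequences *)

Section IdealTheory.
Variable R : comNzRingType.
Implicit Types (I J A B P : set R) (s : seq R).

Lemma ideal0 I : is_ideal I -> I 0. Proof. by case. Qed.

Lemma idealMD I a u v : is_ideal I -> I u -> I v -> I (a * u + v).
Proof. by case=> _; apply. Qed.

Lemma idealD I u v : is_ideal I -> I u -> I v -> I (u + v).
Proof. by move=> hI hu hv; rewrite -[u]mul1r; apply: idealMD. Qed.

Lemma idealMr I a u : is_ideal I -> I u -> I (a * u).
Proof. by move=> hI hu; rewrite -[a * u]addr0; apply: idealMD => //; apply: ideal0. Qed.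

Lemma idealMl I a u : is_ideal I -> I u -> I (u * a).
Proof. by move=> hI hu; rewrite mulrC; apply: idealMr. Qed.

Lemma idealN I u : is_ideal I -> I u -> I (- u).
Proof. by move=> hI hu; rewrite -mulN1r; apply: idealMr. Qed.

Lemma idealB I u v : is_ideal I -> I u -> I v -> I (u - v).
Proof. by move=> hI hu hv; apply: idealD => //; apply: idealN. Qed.

Lemma ideal_subr I u v : is_ideal I -> I (u - v) -> I v -> I u.
Proof. by move=> hI huv hv; rewrite -[u](subrK v); apply: idealD. Qed.

Lemma ideal_subl I u v : is_ideal I -> I (u - v) -> I u -> I v.
Proof. by move=> hI huv hu; rewrite -[v](subKr u); apply: idealB. Qed.

Lemma ideal_sum I (T : Type) (r : seq T) (Q : pred T) (F : T -> R) :
  is_ideal I -> (forall i, Q i -> I (F i)) -> I (\sum_(i <- r | Q i) F i).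
Proof.
move=> hI hF; apply: (big_ind I); [exact: ideal0 | by move=> *; apply: idealD | exact: hF].
Qed.

Lemma ideal_gen_ideal (G : set R) : is_ideal (ideal_gen G).
Proof.
split; first by exists [::]; rewrite ?big_nil.
move=> a u v [s hs ->] [t ht ->].
exists ([seq (a * x.1, x.2) | x <- s] ++ t) => [x|].
  by rewrite mem_cat => /orP[/mapP[y /hs hy ->]|/ht].
by rewrite big_cat big_map /= mulr_sumr; congr (_ + _); apply: eq_bigr => i _; rewrite mulrA.
Qed.

Lemma mem_ideal_gen (G : set R) x : G x -> ideal_gen G x.
Proof.
by move=> Gx; exists [:: (1, x)]; [move=> y; rewrite inE => /eqP -> | rewrite big_seq1 mul1r].
Qed.

Lemma ideal_gen_min (G : set R) I :
  is_ideal I -> (forall x, G x -> I x) -> forall x, ideal_gen G x -> I x.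
Proof.
move=> hI hG x [s hs ->]; rewrite big_seq; apply: ideal_sum => // i /hs/hG.
exact: idealMr.
Qed.

(** The ideal I + yR, in a form that directly exhibits the cofactor of y. *)
Definition ideal_plus I (y : R) : set R := [set g | exists h, I (g - y * h)]%classic.

Lemma ideal_plus_ideal I y : is_ideal I -> is_ideal (ideal_plus I y).
Proof.
move=> hI; split; first by exists 0; rewrite mulr0 subr0; apply: ideal0.
move=> a u v [h hu] [h' hv]; exists (a * h + h').
have -> : a * u + v - y * (a * h + h') = a * (u - y * h) + (v - y * h') by ring.
exact: idealMD.
Qed.

Lemma prime_idealM P u v : prime_ideal P -> ~ P u -> ~ P v -> ~ P (u * v).
Proof. by case=> _ _ hP hu hv /hP[]. Qed.

Lemma prime_idealX P u m : prime_ideal P -> P (u ^+ m) -> P u.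
Proof.
move=> [hI h1 hP]; elim: m => [|m IH]; first by rewrite expr0.
by rewrite exprS => /hP[].
Qed.

(** A / B is generated by the class of u, whose annihilator is P. The lift [f] picks a coefficient
    of u for each element of A; two choices differ by an element of P. *)
Lemma quotient_iso_cyclic A B P u :
  is_ideal A -> is_ideal B -> is_ideal P -> (forall b, B b -> A b) -> A u ->
  (forall a, A a -> exists c, B (a - c * u)) -> (forall c, B (c * u) <-> P c) ->
  quotient_iso A B setT P.
Proof.
move=> hA hB hP hBA hAu hgen hcol.
have /choice[f hf] : forall a, exists c, A a -> B (a - c * u).
  move=> a; have [Aa|nAa] := pselect (A a); last by exists 0.
  by have [c hc] := hgen a Aa; exists c.
exists f; split=> //.
- move=> r a b Aa Ab; apply/hcol.
  have Ac : A (r * a + b) by apply: idealMD.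
  have -> : (f (r * a + b) - (r * f a + f b)) * u =
     r * (a - f a * u) + (b - f b * u) - (r * a + b - f (r * a + b) * u) by ring.
  by apply: idealB (hf _ Ac) => //; apply: idealMD => //; apply: hf.
- move=> a Aa; rewrite -hcol; split=> h; first exact: ideal_subr (hf a Aa) h.
  exact: ideal_subl (hf a Aa) h.
- move=> c _; exists (c * u); first exact: idealMr.
  apply/hcol; rewrite mulrBl -[_ - _]opprK opprB; apply: idealN => //.
  by rewrite -[_ - _]opprK opprB; apply: idealN => //; apply: hf; apply: idealMr.
Qed.

(** Properness of J + (t1, t2) is left out, so that the unit ideal at the top of a filtration
    satisfies the condition and can start an induction. *)
Definition regular2 J (t1 t2 : R) : Prop :=
  (forall g, J (t1 * g) -> J g) /\
  (forall g h, J (t2 * g - t1 * h) -> exists h', J (g - t1 * h')).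

Lemma ideal_adjoin_nil J : is_ideal J -> ideal_adjoin J [::] = J.
Proof.
move=> hJ; apply/seteqP; split=> x.
  by apply: ideal_gen_min => // y [|].
by move=> Jx; apply: mem_ideal_gen; left.
Qed.

Lemma ideal_adjoin_rcons J s y : is_ideal J ->
  ideal_adjoin J (rcons s y) = ideal_plus (ideal_adjoin J s) y.
Proof.
move=> hJ; have hs := ideal_gen_ideal; apply/seteqP; split=> x.
  apply: ideal_gen_min; first by apply: ideal_plus_ideal; apply: hs.
  move=> z; case=> [Jz|/=].
    by exists 0; rewrite mulr0 subr0; apply: mem_ideal_gen; left.
  rewrite mem_rcons inE => /orP[/eqP ->|zs].
    by exists 1; rewrite mulr1 subrr; apply: ideal0; apply: hs.
  by exists 0; rewrite mulr0 subr0; apply: mem_ideal_gen; right.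
case=> h hx; rewrite -[x](subrK (y * h)); apply: idealD; first exact: hs.
  apply: ideal_gen_min hx; first exact: hs.
  move=> z [Jz|zs]; apply: mem_ideal_gen; [by left | right] => /=.
  by rewrite mem_rcons inE zs orbT.
apply: idealMl; first exact: hs.
by apply: mem_ideal_gen; right; rewrite /= mem_rcons mem_head.
Qed.

Lemma ideal_adjoin1 J y : is_ideal J -> ideal_adjoin J [:: y] = ideal_plus J y.
Proof. by move=> hJ; rewrite -[[:: y]]/(rcons [::] y) ideal_adjoin_rcons ?ideal_adjoin_nil. Qed.

Lemma regular_seq_regular2 J s : is_ideal J -> regular_seq_quo J s ->
  (1 < size s)%N -> regular2 J s`_0 s`_1.
Proof.
move=> hJ [hs _] h2; split=> [g|g h hg].
  by have := hs 0%N (ltnW h2) g; rewrite take0 ideal_adjoin_nil.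
have := hs 1%N h2 g; rewrite (take_nth 0) ?(ltnW h2) // take0 /= ideal_adjoin1 //.
by apply; exists h.
Qed.

Lemma regular2_regular_seq J m (t1 t2 : R) : is_ideal J -> is_ideal m -> ~ m 1 ->
  (forall x, J x -> m x) -> m t1 -> m t2 -> regular2 J t1 t2 ->
  regular_seq_quo J [:: t1; t2].
Proof.
move=> hJ hm hm1 hJm mt1 mt2 [r1 r2]; split.
  case=> [|[|//]] _ g /=; first by rewrite ideal_adjoin_nil //; apply: r1.
  by rewrite ideal_adjoin1 // => -[h /r2].
move=> h1; apply: hm1; apply: ideal_gen_min h1 => // x [/hJm //|].
by rewrite /= !inE => /orP[] /eqP ->.
Qed.

(* The regularity of a sequence on the outer terms of the exact sequence
   0 -> R/P -> R/B -> R/A -> 0 implies it on the middle one. *)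
Lemma regular2_filtration A B P t1 t2 :
  is_ideal A -> is_ideal B -> is_ideal P -> (forall b, B b -> A b) ->
  quotient_iso A B setT P -> regular2 A t1 t2 -> regular2 P t1 t2 ->
  regular2 B t1 t2.
Proof.
move=> hA hB hP hBA [f [_ flin fker fsur]] [a1 a2] [p1 p2].
have A0 := ideal0 hA.
have fM r a : A a -> P (f (r * a) - r * f a).
  move=> Aa; have := flin r a 0 Aa A0; rewrite addr0 => h.
  have /(idealD hP h) : P (f 0) by apply/fker => //; apply: ideal0.
  by rewrite [X in P X](_ : _ = f (r * a) - r * f a) //; ring.
have fB a b : A a -> A b -> P (f (a - b) - (f a - f b)).
  move=> Aa Ab; have := flin (-1) b a Ab Aa; rewrite mulN1r [- b + a]addrC.
  by rewrite [X in P X -> _](_ : _ = f (a - b) - (f a - f b)) //; ring.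
split=> [g hg|g h hgh].
  have Ag : A g by apply: a1; apply: hBA.
  apply/fker => //; apply: p1; apply: ideal_subl (fM t1 g Ag) _ => //.
  by apply/fker => //; apply: idealMr.
(* Regularity on R/A gives g = t1 h1 modulo A. The error b' in A is then handled in R/P, through
   f. *)
have [h1 Ah1] := a2 _ _ (hBA _ hgh).
set b' := g - t1 * h1 in Ah1.
have Bk : B (t2 * b' - t1 * (h - t2 * h1)).
  by rewrite [X in B X](_ : _ = t2 * g - t1 * h) // /b'; ring.
have Ah2 : A (h - t2 * h1).
  apply: a1; apply: ideal_subl (hBA _ Bk) _ => //; exact: idealMr.
set h2 := h - t2 * h1 in Bk Ah2.
have Ak1 : A (t2 * b') by apply: idealMr.
have Ak2 : A (t1 * h2) by apply: idealMr.
have Pk : P (t2 * f b' - t1 * f h2).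
  have Pf : P (f (t2 * b' - t1 * h2)) by apply/fker => //; apply: idealB.
  have h3 := ideal_subl hP (fB _ _ Ak1 Ak2) Pf.
  have := idealD hP (idealB hP h3 (fM t2 _ Ah1)) (fM t1 _ Ah2).
  by rewrite [X in P X -> _](_ : _ = t2 * f b' - t1 * f h2) //; ring.
have [q Pq] := p2 _ _ Pk.
have [b2 Ab2 Pb2] := fsur q I.
exists (h1 + b2); rewrite [X in B X](_ : _ = b' - t1 * b2); last by rewrite /b'; ring.
have Atb : A (t1 * b2) by apply: idealMr.
apply/fker; first exact: idealB.
apply: ideal_subr (fB _ _ Ah1 Atb) _ => //.
have := idealB hP (idealD hP Pq (idealMr t1 hP Pb2)) (fM t1 _ Ab2).
by rewrite [X in P X -> _](_ : _ = f b' - f (t1 * b2)) //; ring.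
Qed.

Lemma regular2X J t1 t2 p q : is_ideal J -> regular2 J t1 t2 ->
  regular2 J (t1 ^+ p) (t2 ^+ q).
Proof.
move=> hJ [r1 r2].
have r1X g a : J (t1 ^+ a * g) -> J g.
  elim: a g => [|a IH] g; first by rewrite expr0 mul1r.
  by rewrite exprSr -mulrA => /IH/r1.
have r2X b : forall g h, J (t2 ^+ b * g - t1 * h) -> exists h', J (g - t1 * h').
  elim: b => [|b IH] g h; first by rewrite expr0 mul1r; exists h.
  rewrite exprSr -mulrA => /IH[h' /r2]; exact.
split=> [g|]; first exact: r1X.
elim: p => [|p IH] g h.
  by rewrite expr0 => _; exists g; rewrite mul1r subrr; apply: ideal0.
(* The second term is a multiple of t1, so g = t1 g1 modulo J; cancelling t1 leaves the same kind of
   relation for g1, with exponent p. *)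
move=> hg; have /r2X[g1 hg1] : J (t2 ^+ q * g - t1 * (t1 ^+ p * h)).
  by rewrite mulrA -exprS.
have /IH[h' hh'] : J (t2 ^+ q * g1 - t1 ^+ p * h).
  apply: r1; have := idealB hJ hg (idealMr (t2 ^+ q) hJ hg1).
  rewrite [X in J X -> _](_ : _ = t1 * (t2 ^+ q * g1 - t1 ^+ p * h)) //.
  by rewrite exprS; ring.
exists h'; have := idealD hJ hg1 (idealMr t1 hJ hh').
by rewrite [X in J X -> _](_ : _ = g - t1 ^+ p.+1 * h') // exprS; ring.
Qed.

(* The first Koszul cohomology of R / J with respect to y vanishes as soon as
   the ideal generated by y contains an R / J - regular sequence of length 2. *)
Lemma koszul1_vanish J (n : nat) (y f a b : 'I_n -> R) t1 t2 :
  is_ideal J -> regular2 J t1 t2 ->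
  t1 = \sum_j a j * y j -> t2 = \sum_j b j * y j ->
  (forall i j, J (y i * f j - y j * f i)) ->
  exists h, forall i, J (f i - y i * h).
Proof.
move=> hJ [r1 r2] e1 e2 hf.
(* If f_i = y_i h, then F = t1 h and G = t2 h; so h has to be F divided by t1, and regularity makes
   this division possible. *)
pose F := \sum_j a j * f j; pose G := \sum_j b j * f j.
have hF i : J (y i * F - t1 * f i).
  rewrite e1 /F mulr_sumr mulr_suml -sumrB; apply: ideal_sum => // j _.
  by have := idealMr (a j) hJ (hf i j); congr J; ring.
have /r2[h hh] : J (t2 * F - t1 * G).
  rewrite {1}e2 /G mulr_suml mulr_sumr -sumrB; apply: ideal_sum => // j _.
  by have := idealMr (b j) hJ (hF j); congr J; ring.
exists h => i; apply: r1.
have := idealB hJ (idealMr (y i) hJ hh) (hF i); congr J; ring.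
Qed.

Lemma sum_split_low (N a0 : nat) (g : nat -> R) x :
  (forall a, (a < a0)%N -> g a = 0) -> (a0 < N)%N ->
  exists r, \sum_(a < N) g a * x ^+ a = x ^+ a0 * (g a0 + r * x).
Proof.
move=> hg; elim: N => [//|N IH]; rewrite ltnS leq_eqVlt big_ord_recr /=.
case/orP=> [/eqP eN|/[dup] lt /IH[r ->]].
  exists 0; rewrite -eN mul0r addr0 big1 ?add0r 1?[x ^+ _ * _]mulrC // => i _.
  by rewrite hg ?mul0r.
exists (r + g N * x ^+ (N - a0.+1)); rewrite -[in x ^+ N](subnKC lt) exprD exprSr.
by ring.
Qed.

End IdealTheory.

(** * Ideals spanned by monomials *)

Section MonomialSpan.
Variables (k : fieldType) (n : nat).
Local Notation S := {mpoly k[n]}.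
Implicit Types (U V : 'X_{1..n} -> Prop) (p q : S) (F G : {set 'I_n}).

(** When U is closed under multiples, this is the monomial ideal whose monomials are those of U;
    inclusions and equalities of such ideals reduce to statements on exponents. *)
Definition mspan U : set S := [set p | forall m, m \in msupp p -> U m]%classic.

Definition upclosed U := forall d m, U m -> U (d + m)%MM.

Lemma mspan_ideal U : upclosed U -> is_ideal (mspan U).
Proof.
move=> hU; split=> [m|a u v hu hv m /msuppD_le]; first by rewrite msupp0.
rewrite mem_cat => /orP[/msuppM_le/allpairsP[[m1 m2] /= [_ h2 ->]]|/hv //].
exact/hU/hu.
Qed.

Lemma mspanX U m : mspan U 'X_[m] <-> U m.
Proof. by split=> [|h m' /mem_msuppXP <- //]; apply; rewrite msuppX mem_head. Qed.

Lemma mspan_min U (I : set S) : is_ideal I ->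
  (forall m, U m -> I 'X_[m]) -> forall p, mspan U p -> I p.
Proof.
move=> hI hU p hp; rewrite (mpolyE p) big_seq; apply: ideal_sum => // m /hp/hU hm.
by rewrite -mul_mpolyC; apply: idealMr.
Qed.

Lemma mspanS U V : (forall m, U m -> V m) -> forall p, mspan U p -> mspan V p.
Proof. by move=> h p hp m /hp/h. Qed.

Lemma eq_mspan U V : (forall m, U m <-> V m) -> mspan U = mspan V.
Proof. by move=> h; apply/seteqP; split; apply: mspanS => m /h. Qed.

Lemma mspan_monomial U : upclosed U -> monomial_ideal (mspan U).
Proof.
move=> hU; exists U; apply/seteqP; split.
  apply: mspan_min; first exact: ideal_gen_ideal.
  by move=> m Um; apply: mem_ideal_gen; exists m.
apply: ideal_gen_min; first exact: mspan_ideal.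
by move=> _ [m Um <-]; apply/mspanX.
Qed.

Lemma mspanMX U p u : mspan U (p * 'X_[u]) <-> mspan (fun m => U (u + m)%MM) p.
Proof.
split=> h m.
  by move=> hm; apply: h; rewrite (perm_mem (msuppMX p u)) map_f.
by rewrite (perm_mem (msuppMX p u)) => /mapP[m' /h ? ->].
Qed.

Definition msubst (s : 'I_n -> S) p : S := p \mPo [tuple s i | i < n].

HB.instance Definition _ s :=
  GRing.RMorphism.copy (msubst s) (@comp_mpoly n k n [tuple s i | i < n]).

Lemma msubstX s m : msubst s 'X_[m] = \prod_i s i ^+ m i.
Proof. by rewrite /msubst comp_mpolyX; apply: eq_bigr => i _; rewrite tnth_mktuple. Qed.

Lemma msubstU s i : msubst s 'X_i = s i.
Proof. by rewrite /msubst comp_mpolyXU -tnth_nth tnth_mktuple. Qed.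

Lemma ideal_prodB (R : comNzRingType) (I : set R) (T : Type) (r : seq T) (f g : T -> R) :
  is_ideal I -> (forall i, I (f i - g i)) ->
  I (\prod_(i <- r) f i - \prod_(i <- r) g i).
Proof.
move=> hI hfg; elim: r => [|x r IH]; first by rewrite !big_nil subrr; apply: ideal0.
rewrite !big_cons; set a := \prod_(j <- r) f j in IH *; set b := \prod_(j <- r) g j in IH *.
have := idealMD (f x) hI IH (idealMr b hI (hfg x)); congr I; ring.
Qed.

Lemma ideal_expB (R : comNzRingType) (I : set R) (x y : R) e :
  is_ideal I -> I (x - y) -> I (x ^+ e - y ^+ e).
Proof.
by move=> hI h; rewrite subrXX; apply: idealMl.
Qed.

Lemma msubst_congr (I : set S) s : is_ideal I -> (forall i, I ('X_i - s i)) ->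
  forall p, I (p - msubst s p).
Proof.
move=> hI hs p; rewrite {2}(mpolyE p) rmorph_sum /= {1}(mpolyE p) -sumrB.
apply: ideal_sum => // m _; rewrite -mul_mpolyC rmorphM /= /msubst comp_mpolyC -mulrBr.
apply: idealMr => //; rewrite -/(msubst s _) msubstX mpolyXE_id.
by apply: ideal_prodB => // i; apply: ideal_expB.
Qed.

Definition face_prime F : set S := mspan (fun m => exists2 j, j \notin F & m j != 0%N).

Lemma face_prime_up F : upclosed (fun m : 'X_{1..n} => exists2 j, j \notin F & m j != 0%N).
Proof. by move=> d m [j jF mj]; exists j => //; rewrite mnmDE addn_eq0 negb_and mj orbT. Qed.

Lemma face_prime_ideal F : is_ideal (face_prime F).
Proof. exact/mspan_ideal/face_prime_up. Qed.

Lemma face_primeU F i : face_prime F 'X_i <-> i \notin F.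
Proof.
rewrite /face_prime mspanX; split=> [[j jF]|iF].
  by rewrite mnm1E eqb0 negbK => /eqP ->.
by exists i; rewrite // mnm1E eqxx.
Qed.

Definition restr F (i : 'I_n) : S := if i \in F then 'X_i else 0.

(** The ideal is the kernel of the substitution that kills the variables outside F; primality
    follows, since polynomials over a field form a domain. *)
Lemma face_primeE F p : face_prime F p <-> msubst (restr F) p = 0.
Proof.
split=> [|h0].
  have hI : is_ideal [set q | msubst (restr F) q = 0]%classic.
    split=> /= [|a u v hu hv]; first exact: rmorph0.
    by rewrite rmorphD rmorphM /= hu hv mulr0 addr0.
  apply: (mspan_min hI) => m [j jF mj] /=; rewrite msubstX (bigD1 j) //= /restr (negbTE jF).
  by rewrite expr0n (negbTE mj) mul0r.
have : face_prime F (p - msubst (restr F) p).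
  apply: msubst_congr => [|i]; first exact: face_prime_ideal.
  rewrite /restr; case: ifPn => [_|iF].
    by rewrite subrr; apply: (ideal0 (face_prime_ideal F)).
  by rewrite subr0; apply/face_primeU.
by rewrite h0 subr0.
Qed.

Lemma face_prime_prime F : prime_ideal (face_prime F).
Proof.
split; first exact: face_prime_ideal.
  by move=> /face_primeE; rewrite rmorph1 => /eqP; rewrite oner_eq0.
move=> u v /face_primeE; rewrite rmorphM /= => /eqP; rewrite mulf_eq0.
by case/orP => /eqP /face_primeE; [left | right].
Qed.

Lemma face_prime_sub F G : F \subset G -> forall p, face_prime G p -> face_prime F p.
Proof.
move=> /fintype.subsetP FG; apply: mspanS => m [j jG mj]; exists j => //.
by apply: contra jG; apply: FG.
Qed.

Lemma face_prime_min F (I : set S) : is_ideal I ->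
  (forall i, i \notin F -> I 'X_i) -> forall p, face_prime F p -> I p.
Proof.
move=> hI h; apply: mspan_min => // m [j /h hj mj].
have -> : m = (m - U_(j) + U_(j))%MM by rewrite submK // lep1mP.
by rewrite mpolyXD; apply: idealMr.
Qed.

Definition sr_mon (Delta : {set {set 'I_n}}) (m : 'X_{1..n}) : Prop :=
  exists2 G, G \notin Delta & forall i, i \in G -> m i != 0%N.

(** I^2 is generated by the products x_G x_G' of two nonface monomials; the exponent of x_i in such
    a product is the sum of the two membership bits. *)
Definition sr2_mon (Delta : {set {set 'I_n}}) (m : 'X_{1..n}) : Prop :=
  exists G G', [/\ G \notin Delta, G' \notin Delta & forall i, ((i \in G) + (i \in G') <= m i)%N].

Variable Delta : {set {set 'I_n}}.

Lemma sr_mon_up : upclosed (sr_mon Delta).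
Proof.
by move=> d m [G hG hm]; exists G => // i /hm h; rewrite mnmDE addn_eq0 negb_and h orbT.
Qed.

Lemma sr2_mon_up : upclosed (sr2_mon Delta).
Proof.
move=> d m [G [G' [hG hG' hm]]]; exists G, G'; split=> // i; rewrite mnmDE.
exact/(leq_trans (hm i))/leq_addl.
Qed.

Lemma prodXE (G : {set 'I_n}) :
  \prod_(i in G) ('X_i : S) = 'X_[[multinom (i \in G : nat) | i < n]].
Proof.
rewrite mprodXE; congr mpolyX; apply/mnmP => j; rewrite mnmE mnm_sumE.
rewrite big_mkcond (bigD1 j) //= mnm1E eqxx big1 ?addn0; first by case: (j \in G).
by move=> i ij; rewrite mnm1E (negbTE ij); case: ifP.
Qed.

Lemma stanley_reisnerE : stanley_reisner k Delta = mspan (sr_mon Delta).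
Proof.
apply/seteqP; split.
  apply: ideal_gen_min; first exact/mspan_ideal/sr_mon_up.
  move=> _ [G /= hG <-]; rewrite prodXE; apply/mspanX; exists G => // i iG.
  by rewrite mnmE iG.
apply: mspan_min; first exact: ideal_gen_ideal.
move=> m [G hG hm].
have -> : m = (m - [multinom (i \in G : nat) | i < n] + [multinom (i \in G : nat) | i < n])%MM.
  rewrite submK //; apply/mnm_lepP => i; rewrite mnmE; case: (boolP (i \in G)) => // /hm.
  by rewrite lt0n.
rewrite mpolyXD; apply: idealMr; first exact: ideal_gen_ideal.
by apply: mem_ideal_gen; exists G => //; rewrite prodXE.
Qed.

Lemma sr_square : let I := stanley_reisner k Delta in ideal_mul I I = mspan (sr2_mon Delta).
Proof.
rewrite /= stanley_reisnerE; apply/seteqP; split.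
  apply: ideal_gen_min; first exact/mspan_ideal/sr2_mon_up.
  move=> _ [u hu [v hv <-]] m /msuppM_le/allpairsP[[m1 m2] /= [/hu [G hG h1] /hv [G' hG' h2] ->]].
  exists G, G'; split=> // i; rewrite mnmDE; apply: leq_add.
    by case: (boolP (i \in G)) => // /h1; rewrite lt0n.
  by case: (boolP (i \in G')) => // /h2; rewrite lt0n.
apply: mspan_min; first exact: ideal_gen_ideal.
move=> m [G [G' [hG hG' hm]]].
pose d := [multinom (i \in G : nat) | i < n].
have -> : m = (m - d + d)%MM.
  by rewrite submK //; apply/mnm_lepP => i; rewrite mnmE; apply: leq_trans (hm i); apply: leq_addr.
rewrite mpolyXD; apply: mem_ideal_gen.
exists 'X_[m - d]; last exists 'X_[d] => //; apply/mspanX.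
  exists G' => // i iG'; rewrite mnmBE mnmE; have := hm i; rewrite iG'; lia.
by exists G => // i iG; rewrite mnmE iG.
Qed.

End MonomialSpan.

Arguments face_prime k {n} F _.

(** * Clean filtrations and Cohen-Macaulayness *)

Section Facets.
Variables (n : nat) (Delta : {set {set 'I_n}}).
Implicit Types (F G : {set 'I_n}).

Lemma face_facet G : G \in Delta -> exists2 F, F \in facets Delta & G \subset F.
Proof.
move=> hG; have [F hF GF] := @maxset_exists _ (mem Delta) G hG.
by exists F; rewrite ?inE.
Qed.

Lemma facet_face F : F \in facets Delta -> F \in Delta.
Proof. by rewrite inE => /maxsetp. Qed.

Lemma facet_max F G : F \in facets Delta -> G \in Delta -> F \subset G -> G = F.
Proof. by rewrite inE => /maxsetP[_ h] hG; apply: h. Qed.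

Lemma nonfaceP G : simplicial_complex Delta ->
  reflect (forall F, F \in facets Delta -> ~~ (G \subset F)) (G \notin Delta).
Proof.
move=> hD; apply: (iffP idP) => [hG F hF|h].
  by apply: contra hG => /(hD _ _ (facet_face hF)).
by apply/negP => /face_facet[F /h /negP].
Qed.

Lemma facets_card2 : pure Delta -> complex_dim Delta = 1 ->
  (exists F, F \in facets Delta) /\ forall F, F \in facets Delta -> #|F| = 2%N.
Proof.
move=> hp hd; have hmax : (\max_(F in facets Delta) #|F|)%N = 2%N.
  by move: hd; rewrite /complex_dim => hd; lia.
have [e|[F0 hF0]] := set_0Vmem (facets Delta).
  by rewrite e big_set0 in hmax.
have [|F1 hF1 e1] := @eq_bigmax_cond _ (mem (facets Delta)) (fun F => #|F|).
  by apply/card_gt0P; exists F0.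
split; first by exists F0.
move=> F hF; have := hp F F1 hF hF1; rewrite /face_dim -e1.
by rewrite [X in _ = X%:Z - 1]hmax => h; lia.
Qed.

End Facets.

(** * Regular sequences along prime filtrations *)

Section Filtrations.
Variables (k : fieldType) (n : nat).
Local Notation S := {mpoly k[n]}.

Lemma regular2_prime_filtration (I : set S) r F P (t1 t2 : S) :
  prime_filtration I r F P -> (forall i, (i < r)%N -> regular2 (P i) t1 t2) ->
  regular2 I t1 t2.
Proof.
move=> [<- Fr hmon hstep] hreg.
have hid i : (i <= r)%N -> is_ideal (F i).
  by move=> /hmon[G ->]; apply: ideal_gen_ideal.
(* The induction descends from the unit ideal, where regularity is trivial, to I. *)
suff h j : (j <= r)%N -> regular2 (F (r - j)%N) t1 t2 by have := h r (leqnn r); rewrite subnn.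
elim: j => [_|j IH jr].
  by rewrite subn0 Fr; split=> // g h _; exists 0.
have lt : (r - j.+1 < r)%N by lia.
have eS : (r - j.+1).+1 = (r - j)%N by lia.
have [sub _ [Pid _ _] iso] := hstep _ lt.
have IH' := IH (ltnW jr); rewrite -eS in IH'.
exact: (regular2_filtration (hid _ lt) (hid _ (ltnW lt)) Pid sub iso IH' (hreg _ lt)).
Qed.

Definition esym1 : S := \sum_i 'X_i.
Definition esym2 : S := \sum_(p : 'I_n * 'I_n | (p.1 < p.2)%N) 'X_p.1 * 'X_p.2.

(** For F = {a, b}, [esym1] restricts to x_a + x_b, a nonzero element of a domain. Setting x_b = -
    x_a turns [esym2] into - x_a^2, which is again nonzero in a domain. *)
Lemma regular2_face_prime (F : {set 'I_n}) : #|F| = 2%N ->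
  regular2 (face_prime k F) esym1 esym2.
Proof.
move=> hF; have /cards2P[a [b [ab eF]]] : #|F| == 2%N by rewrite hF.
wlog lt : a b ab eF / (a < b)%N.
  move=> hw; have [lt|lt|/val_inj e] := ltngtP a b; first exact: hw lt.
    by apply: hw lt; rewrite 1?eq_sym // finset.setUC.
  by rewrite e eqxx in ab.
have hI := face_prime_ideal k F.
have aF : a \in F by rewrite eF !inE eqxx.
have bF : b \in F by rewrite eF !inE eqxx orbT.
have out i : i != a -> i != b -> i \notin F by move=> ia ib; rewrite eF !inE negb_or ia.
have e1 : msubst (restr k F) esym1 = 'X_a + 'X_b.
  rewrite rmorph_sum (bigD1 a) //= (bigD1 b) 1?eq_sym //= !msubstU /restr aF bF.
  rewrite big1 ?addr0 // => i /andP[ia ib]; rewrite msubstU.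
  by rewrite (negbTE (out i ia ib)).
(* The zeros of the face prime of F and of esym1 form the line x_b = - x_a. *)
pose s i : S := if i == a then 'X_a else if i == b then - 'X_a else 0.
have sout i : i \notin F -> s i = 0.
  by rewrite eF !inE negb_or /s => /andP[/negbTE -> /negbTE ->].
have s1 : msubst s esym1 = 0.
  rewrite rmorph_sum (bigD1 a) //= (bigD1 b) 1?eq_sym //= !msubstU /s eqxx.
  rewrite [b == a]eq_sym (negbTE ab) eqxx addrA subrr add0r.
  by rewrite big1 // => i /andP[ia ib]; rewrite msubstU /s (negbTE ia) (negbTE ib).
have s2 : msubst s esym2 = - 'X_a ^+ 2.
  rewrite rmorph_sum (bigD1 (a, b)) //= rmorphM /= !msubstU {1 2}/s eqxx.
  rewrite [b == a]eq_sym (negbTE ab) eqxx big1 ?addr0 ?mulrN //.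
  move=> [i j] /= /andP[ij ne]; rewrite rmorphM /= !msubstU.
  case: (boolP (i \in F)) => [iF|/sout ->]; last by rewrite mul0r.
  case: (boolP (j \in F)) => [jF|/sout ->]; last by rewrite mulr0.
  move: iF jF; rewrite eF !inE => /orP[] /eqP ei /orP[] /eqP ej; subst i j.
  - by rewrite ltnn in ij.
  - by rewrite eqxx in ne.
  - by have := ltn_trans ij lt; rewrite ltnn.
  - by rewrite ltnn in ij.
have sP p : face_prime k F p -> msubst s p = 0.
  have hK : is_ideal [set q | msubst s q = 0]%classic.
    split=> /= [|x u v hu hv]; first exact: rmorph0.
    by rewrite rmorphD rmorphM /= hu hv mulr0 addr0.
  apply: (face_prime_min hK) => i iF /=.
  by rewrite msubstU sout.
have Xa0 : 'X_a != 0 :> S.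
  by apply/eqP => /(congr1 (mcoeff U_(a))); rewrite mcoeffX eqxx mcoeff0 => /eqP; rewrite oner_eq0.
split=> [g /face_primeE|g h /sP].
  rewrite rmorphM /= e1 => /eqP; rewrite mulf_eq0 => /orP[/eqP|/eqP/face_primeE //].
  move=> /(congr1 (mcoeff U_(a))); rewrite mcoeffD !mcoeffX eqxx eq_mnm1 eq_sym.
  by rewrite (negbTE ab) addr0 mcoeff0 => /eqP; rewrite oner_eq0.
rewrite rmorphB !rmorphM /= s1 s2 mul0r subr0 => /eqP.
rewrite mulf_eq0 oppr_eq0 expf_eq0 (negbTE Xa0) /= => /eqP sg0.
have hP := ideal_plus_ideal esym1 hI.
(* Modulo P_F + ([esym1]) each variable equals its image under [s], so g is congruent to its
   restriction to the line, which has just been shown to vanish. *)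
have : ideal_plus (face_prime k F) esym1 (g - msubst s g).
  have inP x : face_prime k F x -> ideal_plus (face_prime k F) esym1 x.
    by move=> hx; exists 0; rewrite mulr0 subr0.
  apply: msubst_congr => // i.
  case: (boolP (i \in F)) => [iF|iF]; last first.
    by rewrite sout // subr0; apply: inP; apply/face_primeU.
  have : i \in [set a; b] by rewrite -eF.
  rewrite !inE => /orP[] /eqP ->; rewrite /s eqxx; first by rewrite subrr; exact: (ideal0 hP).
  rewrite [b == a]eq_sym (negbTE ab) opprK; exists 1; rewrite mulr1.
  rewrite /esym1 (bigD1 a) //= (bigD1 b) 1?eq_sym //= addrA opprD addrA ['X_b + _]addrC subrr sub0r.
  apply: (idealN hI); apply: (ideal_sum _ hI) => j /andP[ja jb].
  by apply/face_primeU/out.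
by rewrite sg0 subr0.
Qed.

End Filtrations.

(** * Bounds on dimension and depth by counting monomials *)

Section Dependence.
Variables (k : fieldType) (n : nat).
Local Notation S := {mpoly k[n]}.
Implicit Types (p q : S) (u : nat -> nat -> nat -> k).

Definition deg_le d p := forall m, m \in msupp p -> (mdeg m <= d)%N.

Lemma deg_leM d e p q : deg_le d p -> deg_le e q -> deg_le (d + e) (p * q).
Proof.
move=> hp hq m /msuppM_le/allpairsP[[m1 m2] /= [/hp h1 /hq h2 ->]].
by rewrite mdegD leq_add.
Qed.

Lemma deg_leX d p e : deg_le d p -> deg_le (d * e) (p ^+ e).
Proof.
move=> hp; elim: e => [|e IH]; last by rewrite exprS mulnS; apply: deg_leM.
by move=> m; rewrite expr0 msupp1 inE => /eqP ->; rewrite mdeg0.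
Qed.

Lemma deg_le_sum d (T : finType) (f : T -> S) :
  (forall i, deg_le d (f i)) -> deg_le d (\sum_i f i).
Proof. by move=> hf m /msupp_sum_le/flattenP[_ /mapP[i _ ->]]; apply: hf. Qed.

Lemma deg_leC d c : deg_le d (c%:MP : S).
Proof. by move=> m; rewrite msuppC; case: ifP => // _; rewrite inE => /eqP ->; rewrite mdeg0. Qed.

Lemma deg_le_msize p : deg_le (msize p) p.
Proof. by move=> m /msize_mdeg_lt/ltnW. Qed.

Lemma deg_leW d e p : (d <= e)%N -> deg_le d p -> deg_le e p.
Proof. by move=> de hp m /hp/leq_trans; apply. Qed.

(** A polynomial in three elements, nested so that its lowest term can be extracted one variable at
    a time. *)
Definition eval3 N u (x0 x1 x2 : S) : S :=
  \sum_(a < N) (\sum_(b < N) (\sum_(c < N) (u a b c)%:MP * x2 ^+ c) * x1 ^+ b) * x0 ^+ a.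

Lemma least_ord N (Q : pred nat) (i : 'I_N) : Q i ->
  exists a, [/\ (a < N)%N, Q a & forall j, (j < a)%N -> ~~ Q j].
Proof.
move=> Qi; case: (@ex_minnP Q) => [|a Qa amin]; first by exists i.
exists a; split=> // [|j]; first exact: leq_ltn_trans (amin _ Qi) (ltn_ord i).
by rewrite ltnNge; apply: contra => /amin.
Qed.

(** The triple (n0, n1, n2) is the lexicographically least one with a nonzero coefficient;
    [sum_split_low] is applied to each of the three nested sums. *)
Lemma lowest_term N u x0 x1 x2 : (exists a b c : 'I_N, u a b c != 0) ->
  exists n0 n1 n2 c r0 r1 r2, c != 0 /\ eval3 N u x0 x1 x2 =
    x0 ^+ n0 * (x1 ^+ n1 * (x2 ^+ n2 * (c%:MP + r2 * x2) + r1 * x1) + r0 * x0).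
Proof.
move=> [a' [b' [c' hu]]].
have [|a [aN /existsP[b1 /existsP[c1 hu1]] amin]] :=
    @least_ord N (fun a => [exists b : 'I_N, exists c : 'I_N, u a b c != 0]) a'.
  by apply/existsP; exists b'; apply/existsP; exists c'.
have [|b [bN /existsP[c2 hu2] bmin]] := @least_ord N (fun b => [exists c : 'I_N, u a b c != 0]) b1.
  by apply/existsP; exists c1.
have [c [cN hu3 cmin]] := @least_ord N (fun c => u a b c != 0) c2 hu2.
have [|r0 e0] := @sum_split_low _ N a
  (fun a => \sum_(b < N) (\sum_(c < N) (u a b c)%:MP * x2 ^+ c) * x1 ^+ b) x0 _ aN.
  move=> i /amin; rewrite negb_exists => /forallP z; rewrite big1 // => j _.
  have := z j; rewrite negb_exists => /forallP zj; rewrite big1 ?mul0r // => l _.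
  by have := zj l; rewrite negbK => /eqP ->; rewrite mul0r.
have [|r1 e1] := @sum_split_low _ N b (fun b => \sum_(c < N) (u a b c)%:MP * x2 ^+ c) x1 _ bN.
  move=> i /bmin; rewrite negb_exists => /forallP z; rewrite big1 // => j _.
  by have := z j; rewrite negbK => /eqP ->; rewrite mul0r.
have [|r2 e2] := @sum_split_low _ N c (fun c => (u a b c)%:MP) x2 _ cN.
  by move=> i /cmin; rewrite negbK => /eqP ->.
exists a, b, c, (u a b c), r0, r1, r2; split=> //.
by rewrite /eval3 e0 e1 e2.
Qed.

Lemma deg_le_eval3 N u x0 x1 x2 D :
  deg_le D x0 -> deg_le D x1 -> deg_le D x2 -> deg_le (3 * (D * N)) (eval3 N u x0 x1 x2).
Proof.
move=> h0 h1 h2; apply: deg_le_sum => a.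
have hX x (i : 'I_N) : deg_le D x -> deg_le (D * N) (x ^+ i).
  by move=> /(@deg_leX _ _ i); apply: deg_leW; rewrite leq_mul2l ltnW ?orbT.
have -> : (3 * (D * N) = (0 + D * N + D * N) + D * N)%N by lia.
apply: deg_leM (hX _ _ h0); apply: deg_le_sum => b.
apply: deg_leM (hX _ _ h1); apply: deg_le_sum => c.
by apply: deg_leM (hX _ _ h2); apply: deg_leC.
Qed.

(** The matrix of coefficients has more rows than columns, hence a nonzero vector in its left
    kernel. *)
Lemma linear_dependence (T C : finType) (w : T -> S) (code : C -> 'X_{1..n}) :
  (#|C| < #|T|)%N ->
  exists2 v : T -> k, exists t, v t != 0 &
    forall c, (\sum_t (v t)%:MP * w t)@_(code c) = 0.
Proof.
move=> hCT; pose M : 'M[k]_(#|T|, #|C|) :=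
  \matrix_(r, c) (w (enum_val r))@_(code (enum_val c)).
have : kermx M != 0.
  rewrite -mxrank_eq0 mxrank_ker -lt0n subn_gt0.
  exact: leq_ltn_trans (rank_leq_col M) hCT.
case/rowV0Pn => v /sub_kermxP vM v0.
have [j vj] : exists j, v 0 j != 0.
  apply/existsP; apply: contraNT v0; rewrite negb_exists => /forallP z.
  by apply/eqP/rowP => j; rewrite mxE; apply/eqP; have := z j; rewrite negbK.
exists (fun t => v 0 (enum_rank t)); first by exists (enum_val j); rewrite enum_valK.
move=> c; have /rowP/(_ (enum_rank c)) := vM; rewrite !mxE => <-.
rewrite raddf_sum (reindex_onto enum_val enum_rank) /=; last by move=> t _; rewrite enum_rankK.
under eq_bigl do rewrite enum_valK eqxx.
by apply: eq_bigr => r _; rewrite mcoeffCM enum_valK !mxE enum_rankK.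
Qed.

Section Bound.
Variable U : 'X_{1..n} -> Prop.
(* The type of the codes expresses that O(K^2) monomials of degree less than K
   lie outside U. *)
Variables (A : finType) (code : forall K, A * ('I_K * 'I_K) -> 'X_{1..n}).
Hypothesis codeP : forall K m, (mdeg m < K)%N -> ~ U m -> exists c, code (K := K) c = m.

(** There are N^3 products of powers of x0, x1, x2 with exponents below N. Their degrees are less
    than K, which is linear in N, and only O(K^2) monomials of degree less than K lie outside U. *)
Lemma dependent3 (x0 x1 x2 : S) : exists N u,
  (exists a b c : 'I_N, u a b c != 0) /\ mspan U (eval3 N u x0 x1 x2).
Proof.
pose D := maxn (msize x0) (maxn (msize x1) (msize x2)).
(* Since K is at most N (3D + 1), the number of codes is at most |A| (3D + 1)^2 N^2 = (N - 1) N^2,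
   which is less than N^3. *)
pose N := (#|A| * (3 * D).+1 ^ 2).+1.
pose K := (3 * (D * N)).+1.
pose T : finType := ('I_N * 'I_N * 'I_N)%type.
pose w (t : T) : S := x2 ^+ t.2 * x1 ^+ t.1.2 * x0 ^+ t.1.1.
have hcard : (#|{: A * ('I_K * 'I_K)}| < #|T|)%N.
  rewrite !card_prod !card_ord.
  have hK : (K <= N * (3 * D).+1)%N by rewrite /K /N; lia.
  apply: (@leq_ltn_trans (#|A| * ((N * (3 * D).+1) * (N * (3 * D).+1)))%N).
    by rewrite leq_mul2l leq_mul ?orbT.
  have -> : (#|A| * ((N * (3 * D).+1) * (N * (3 * D).+1)) = N * N * N.-1)%N.
    by rewrite /N /=; ring.
  by rewrite ltn_pmul2l.
have [v [t vt] hv] := linear_dependence w (code (K := K)) hcard.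
pose u a b c := if insub a is Some a' then if insub b is Some b' then
  if insub c is Some c' then v (a', b', c') else 0 else 0 else 0.
have uE (a b c : 'I_N) : u a b c = v (a, b, c) by rewrite /u !valK.
have evE : eval3 N u x0 x1 x2 = \sum_t (v t)%:MP * w t.
  transitivity (\sum_a \sum_b \sum_c (v (a, b, c))%:MP * w (a, b, c)); last first.
    by rewrite pair_bigA pair_bigA; apply: eq_bigr => [[[a b] c]] _.
  apply: eq_bigr => a _; rewrite mulr_suml; apply: eq_bigr => b _.
  rewrite !mulr_suml; apply: eq_bigr => c _.
  by rewrite uE /w /= !mulrA.
exists N, u; split.
  by case: t vt => [[a b] c] vt; exists a, b, c; rewrite uE.
move=> m hm; apply: contrapT => nU.
have hdeg : deg_le (3 * (D * N)) (eval3 N u x0 x1 x2).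
  by apply: deg_le_eval3; apply: deg_leW (@deg_le_msize _); rewrite /D; lia.
have [|c ec] := @codeP K m _ nU; first by rewrite ltnS; apply: hdeg.
by move: hm; rewrite mcoeff_msupp evE -ec hv eqxx.
Qed.

Lemma lowest_term_in (x0 x1 x2 : S) : exists n0 n1 n2 c r0 r1 r2, c != 0 /\
  mspan U (x0 ^+ n0 * (x1 ^+ n1 * (x2 ^+ n2 * (c%:MP + r2 * x2) + r1 * x1) + r0 * x0)).
Proof.
have [N [u [hu hJ]]] := dependent3 x0 x1 x2.
have [n0 [n1 [n2 [c [r0 [r1 [r2 [hc e]]]]]]]] := lowest_term x0 x1 x2 hu.
by exists n0, n1, n2, c, r0, r1, r2; split=> //; rewrite -e.
Qed.

Hypothesis upU : upclosed U.

Lemma ideal_const1 (I : set S) c : is_ideal I -> c != 0 -> I c%:MP -> I 1.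
Proof.
move=> hI hc h; rewrite -mpolyC1 -(mulVf hc) mpolyCM; exact: idealMr.
Qed.

(** With x_i in P_(i+1) but not in P_i, the power of x_i cancels in P_i and the tail r_i x_i
    disappears in P_(i+1). After three rounds the nonzero constant c lies in P_3. *)
Lemma prime_chain_le2 e P : prime_chain (mspan U : set S) e P -> (e <= 2)%N.
Proof.
move=> [hP hlt]; rewrite leqNgt; apply/negP => e3.
have [x0 [x00 x01]] : exists x, ~ P 0%N x /\ P 1%N x.
  have [|_ /existsNP[x /not_implyP[h1 h0]]] := hlt 0%N; first lia.
  by exists x.
have [x1 [x11 x12]] : exists x, ~ P 1%N x /\ P 2%N x.
  have [|_ /existsNP[x /not_implyP[h1 h0]]] := hlt 1%N; first lia.
  by exists x.
have [x2 [x22 x23]] : exists x, ~ P 2%N x /\ P 3%N x.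
  have [|_ /existsNP[x /not_implyP[h1 h0]]] := hlt 2%N; first lia.
  by exists x.
have [p0 s0] : prime_ideal (P 0%N) /\ (mspan U `<=` P 0%N)%classic by apply: hP.
have [p1 _] : prime_ideal (P 1%N) /\ (mspan U `<=` P 1%N)%classic by apply: hP; lia.
have [p2 _] : prime_ideal (P 2%N) /\ (mspan U `<=` P 2%N)%classic by apply: hP; lia.
have [p3 _] : prime_ideal (P 3%N) /\ (mspan U `<=` P 3%N)%classic by apply: hP.
have s01 : (P 0%N `<=` P 1%N)%classic by have [] := hlt 0%N; first lia.
have s12 : (P 1%N `<=` P 2%N)%classic by have [] := hlt 1%N; first lia.
have s23 : (P 2%N `<=` P 3%N)%classic by have [] := hlt 2%N; first lia.
have [n0 [n1 [n2 [c [r0 [r1 [r2 [hc /s0 h]]]]]]]] := lowest_term_in x0 x1 x2.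
have step (Q Q' : set S) x m g r : prime_ideal Q -> prime_ideal Q' -> (Q `<=` Q')%classic ->
    ~ Q x -> Q' x -> Q (x ^+ m * (g + r * x)) -> Q' g.
  move=> hQ [hI' _ _] sQ Qx Q'x; case: (hQ) => hI _ hM /hM[/(prime_idealX hQ) //|/sQ h'].
  have := idealB hI' h' (idealMr r hI' Q'x); by rewrite addrK.
have := step _ _ _ _ _ _ p0 p1 s01 x00 x01 h.
move=> /(step _ _ _ _ _ _ p1 p2 s12 x11 x12)/(step _ _ _ _ _ _ p2 p3 s23 x22 x23) h3.
by case: p3 => hI h1 _; apply: h1; apply: ideal_const1 hc h3.
Qed.

(** The lowest term is peeled as for chains of primes: regularity cancels the power of s_i, and
    adjoining s_i removes the tail. *)
Lemma regular_seq_le2 s : regular_seq_quo (mspan U : set S) s -> (size s <= 2)%N.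
Proof.
move=> [hs h1]; rewrite leqNgt; apply/negP => s3.
have hI i : is_ideal (ideal_adjoin (mspan U) (take i s)) by apply: ideal_gen_ideal.
have [n0 [n1 [n2 [c [r0 [r1 [r2 [hc h]]]]]]]] := lowest_term_in s`_0 s`_1 s`_2.
have step i m g r : (i < size s)%N ->
    ideal_adjoin (mspan U) (take i s) (s`_i ^+ m * (g + r * s`_i)) ->
    ideal_adjoin (mspan U) (take i.+1 s) g.
  move=> lt h'.
  have : ideal_adjoin (mspan U) (take i s) (g + r * s`_i).
    elim: m h' => [|m IH]; first by rewrite expr0 mul1r.
    by rewrite exprS -mulrA => /(hs _ lt).
  rewrite (take_nth 0) // ideal_adjoin_rcons; last exact: mspan_ideal.
  by exists (- r); congr (ideal_adjoin _ _ _): H; ring.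
have h0 : ideal_adjoin (mspan U) (take 0 s) (s`_0 ^+ n0 * (s`_1 ^+ n1 *
     (s`_2 ^+ n2 * (c%:MP + r2 * s`_2) + r1 * s`_1) + r0 * s`_0)).
  by rewrite take0 ideal_adjoin_nil //; apply: mspan_ideal.
have h3 := step _ _ _ _ s3 (step _ _ _ _ (ltnW s3) (step _ _ _ _ (ltnW (ltnW s3)) h0)).
apply: h1; apply: ideal_gen_min (ideal_const1 (hI 3) hc h3); first exact: ideal_gen_ideal.
move=> x [Jx|/= xs]; apply: mem_ideal_gen; [by left | by right; apply: mem_take xs].
Qed.

End Bound.
End Dependence.

(** * Minimal primes and dimension of the square *)

Section SquareFacts.
Variables (k : fieldType) (n : nat) (Delta : {set {set 'I_n}}).
Hypotheses (hDelta : simplicial_complex Delta)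
  (hex : exists F, F \in facets Delta)
  (hcard : forall F, F \in facets Delta -> #|F| = 2%N).
Local Notation S := {mpoly k[n]}.
Local Notation J := (mspan (sr2_mon Delta) : set S).

Lemma sr2_ideal : is_ideal J.
Proof. exact/mspan_ideal/sr2_mon_up. Qed.

(** For a monomial outside I^2, the variables of exponent at least 2 form a face, hence lie in some
    edge {a, b}. The monomial is recovered from its support, a, b and the exponents of x_a and
    x_b. *)
Definition sr2_code K (c : ({set 'I_n} * ('I_n * 'I_n)) * ('I_K * 'I_K)) : 'X_{1..n} :=
  [multinom if l == c.1.2.1 then c.2.1 : nat else
            if l == c.1.2.2 then c.2.2 : nat else l \in c.1.1 | l < n].

Lemma sr2_codeP K m : (mdeg m < K)%N -> ~ sr2_mon Delta m ->
  exists c, sr2_code (K := K) c = m.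
Proof.
move=> mK nm; have mi i : (m i < K)%N.
  by apply: leq_ltn_trans mK; rewrite mdegE (bigD1 i) //= leq_addr.
have [big|nbig] := boolP ([set l | (1 < m l)%N]%SET \in Delta); last first.
  case: nm; exists [set l | (1 < m l)%N]%SET, [set l | (1 < m l)%N]%SET; split=> // i.
  by rewrite !inE; case: ltnP.
have [F hF /fintype.subsetP sub] := face_facet big.
have /cards2P[a [b [ab eF]]] : #|F| == 2%N by rewrite hcard.
exists (([set l | (0 < m l)%N]%SET, (a, b)), (Ordinal (mi a), Ordinal (mi b))).
apply/mnmP => l; rewrite mnmE /=; case: eqP => [-> //|/eqP la]; case: eqP => [-> //|/eqP lb].
have : l \notin [set l | (1 < m l)%N]%SET.
  by apply/negP => /sub; rewrite eF !inE (negbTE la) (negbTE lb).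
by rewrite !inE -leqNgt; case: (m l) => [|[|]].
Qed.

Lemma sr2_face_prime F p : F \in facets Delta -> J p -> face_prime k F p.
Proof.
move=> hF; apply: mspanS => m [G [G' [hG _ hm]]].
have /subsetPn[i iG iF] := nonfaceP G hDelta hG F hF.
by exists i => //; have := hm i; rewrite iG -lt0n; lia.
Qed.

(** The variables outside Q form a face G: otherwise x_G^2 is in I^2, hence x_G is in Q, against
    primality. Any facet containing G will do. *)
Lemma prime_over_sr2 (Q : set S) : prime_ideal Q -> (forall p, J p -> Q p) ->
  exists2 F, F \in facets Delta & forall p, face_prime k F p -> Q p.
Proof.
move=> hQ hJ; have [hI _ hM] := hQ.
pose G := [set i : 'I_n | ~~ `[< Q 'X_i >]]%SET.
have [hG|hG] := boolP (G \in Delta).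
  have [F hF /fintype.subsetP sub] := face_facet hG; exists F => //.
  apply: face_prime_min => // i iF; apply: contrapT => nQ; case/negP: iF; apply: sub.
  by rewrite inE; apply/asboolPn.
have : Q ('X_[[multinom (i \in G : nat) | i < n]] ^+ 2).
  apply: hJ; rewrite mpolyXn; apply/mspanX; exists G, G; split=> // i.
  by rewrite mulmnE mnmE muln2 addnn.
move=> /(prime_idealX hQ); rewrite -prodXE => h; exfalso.
suff : ~ Q (\prod_(i in G) 'X_i) by [].
apply: (big_ind (fun x => ~ Q x)); [by case: hQ | by move=> *; apply: prime_idealM |].
by move=> i; rewrite inE => /asboolPn.
Qed.

Lemma sr2_minimal_primes :
  minimal_primes J = [set P | exists2 F, F \in facets Delta & P = face_prime k F]%classic.
Proof.
apply/seteqP; split=> [P [hP hJ hmin]|_ [F hF ->]].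
  have [F hF hFP] := prime_over_sr2 hP hJ; exists F => //; symmetry.
  by apply: hmin => //; [exact: face_prime_prime | move=> p; apply: sr2_face_prime].
split; [exact: face_prime_prime | by move=> p; apply: sr2_face_prime|].
move=> Q hQ hJ hQF; have [F' hF' hFQ] := prime_over_sr2 hQ hJ.
have sub : F \subset F'.
  apply/fintype.subsetP => i; apply: contraTT => /(face_primeU k)/hFQ/hQF/face_primeU.
  by [].
have e := facet_max hF (facet_face hF') sub.
by apply/seteqP; split=> // p hp; apply: hFQ; rewrite e.
Qed.

Lemma graded_max_idealE : @graded_max_ideal k n = face_prime k finset.set0.
Proof.
apply/seteqP; split.
  apply: ideal_gen_min; first exact: face_prime_ideal.
  by move=> _ [i _ <-]; apply/face_primeU; rewrite inE.
apply: face_prime_min; first exact: ideal_gen_ideal.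
by move=> i _; apply: mem_ideal_gen; exists i.
Qed.

Lemma sr2_chain : exists P, prime_chain J 2 P.
Proof.
have [F hF] := hex; have /cards2P[a [b [ab eF]]] : #|F| == 2%N by rewrite hcard.
pose G i := if i is 0 then F else if i is 1 then [set a]%SET else finset.set0.
have s01 : [set a] \subset F by rewrite finset.sub1set eF !inE eqxx.
exists (fun i => face_prime k (G i)); split=> i hi.
  split; first exact: face_prime_prime.
  move=> p /(sr2_face_prime hF); apply: face_prime_sub.
  by case: i {hi} => [|[|i]] //=; rewrite finset.sub0set.
case: i hi => [|[|//]] _ /=; split.
- exact: face_prime_sub.
- move=> /(_ 'X_b); rewrite !face_primeU => /(_ _)/negP; apply; last by rewrite eF !inE eqxx orbT.
  by rewrite inE eq_sym.
- by apply: face_prime_sub; rewrite finset.sub0set.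
- move=> /(_ 'X_a); rewrite !face_primeU => /(_ _)/negP; apply; last by rewrite inE eqxx.
  by rewrite inE.
Qed.

Lemma sr2_krull_dim : krull_dim_quo J 2.
Proof.
by split=> [|e P]; [exact: sr2_chain | exact: (prime_chain_le2 sr2_codeP)].
Qed.

Lemma sr2_clean_cm : clean_quo J -> cohen_macaulay_quo J.
Proof.
move=> [r [F [P [hfil hsupp]]]]; exists 2; split; last exact: sr2_krull_dim.
have hreg : regular2 J (esym1 k n) (esym2 k n).
  apply: regular2_prime_filtration hfil _ => i ir.
  have : minimal_primes J (P i) by rewrite -hsupp; exists i.
  by rewrite sr2_minimal_primes => -[G /hcard hG ->]; apply: regular2_face_prime.
have hm i : face_prime k finset.set0 ('X_i : S) by apply/face_primeU; rewrite inE.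
have hmI := face_prime_ideal k (finset.set0 : {set 'I_n}).
have m1 : face_prime k finset.set0 (esym1 k n).
  by apply: (ideal_sum _ hmI).
have m2 : face_prime k finset.set0 (esym2 k n).
  by apply: (ideal_sum _ hmI) => -[i j] _; apply: (idealMr _ hmI).
split; last by move=> s _; apply: regular_seq_le2 sr2_codeP (@sr2_mon_up _ _) _.
exists [:: esym1 k n; esym2 k n]; split=> //.
  by move=> x; rewrite graded_max_idealE !inE => /orP[] /eqP ->.
apply: (regular2_regular_seq sr2_ideal hmI) => //.
  by case: (face_prime_prime k (finset.set0 : {set 'I_n})).
have [G hG] := hex; move=> x /(sr2_face_prime hG).
by apply: face_prime_sub; rewrite finset.sub0set.
Qed.

End SquareFacts.

(** * Consequences of depth at least 2 *)

Section DepthConsequences.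
Variables (k : fieldType) (n : nat).
Local Notation S := {mpoly k[n]}.
Local Notation maxid := (face_prime k (finset.set0 : {set 'I_n})).

(** The power involves only monomials of degree greater than n T; by the pigeonhole principle each
    is divisible by some x_j^T. *)
Lemma max_ideal_power (t : S) T : maxid t ->
  exists a : 'I_n -> S, t ^+ (n * T).+1 = \sum_j a j * 'X_j ^+ T.
Proof.
move=> ht; have hpow e : mspan (fun m => e <= mdeg m)%N (t ^+ e).
  elim: e => [|e IH] m //; rewrite exprS => /msuppM_le/allpairsP[[m1 m2] /= [/ht h1 /IH h2 ->]].
  rewrite mdegD -addn1 addnC leq_add //; have [j _ mj] := h1.
  by rewrite mdegE (bigD1 j) //= -lt0n in mj *; apply: leq_trans mj (leq_addr _ _).
pose I := [set p : S | exists a : 'I_n -> S, p = \sum_j a j * 'X_j ^+ T]%classic.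
have hI : is_ideal I.
  split; first by exists (fun _ => 0); rewrite big1 // => i _; rewrite mul0r.
  move=> x _ _ [a ->] [b ->]; exists (fun j => x * a j + b j).
  by rewrite mulr_sumr -big_split; apply: eq_bigr => j _ /=; rewrite mulrDl mulrA.
suff : I (t ^+ (n * T).+1) by [].
apply: mspan_min hI _ _ (hpow _) => m hm.
have [j hj] : exists j, (T <= m j)%N.
  apply: contrapT => hno; move: hm; rewrite mdegE ltnNge => /negP; apply.
  rewrite -[n in (n * T)%N]card_ord -sum_nat_const; apply: leq_sum => j _.
  by rewrite leqNgt; apply/negP => lt; apply: hno; exists j; apply: ltnW.
have -> : m = (m - U_(j) *+ T + U_(j) *+ T)%MM.
  rewrite submK //; apply/mnm_lepP => i; rewrite mulmnE mnm1E.
  by case: eqP => [<-|_]; rewrite ?mul1n.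
exists (fun i => if i == j then 'X_[m - U_(j) *+ T] else 0).
rewrite (bigD1 j) //= eqxx mpolyXD mpolyXn big1 ?addr0 // => i /negbTE ->.
by rewrite mul0r.
Qed.

Variable U : 'X_{1..n} -> Prop.
Hypothesis upU : upclosed U.
Local Notation J := (mspan U : set S).
Variables t1 t2 : S.
Hypotheses (m1 : maxid t1) (m2 : maxid t2) (hreg : regular2 J t1 t2).

Let hJ : is_ideal J := @mspan_ideal k n U upU.

(** The fractions f_i / x_i^T agree on overlaps and define a section over the punctured spectrum.
    Suitable powers of t1 and t2 lie in the ideal (x_1^T, ..., x_n^T), so the Koszul argument
    extends it to h. *)
Lemma depth2_section T (f : 'I_n -> S) :
  (forall i j, J ('X_i ^+ T * f j - 'X_j ^+ T * f i)) ->
  exists h, forall i, J (f i - 'X_i ^+ T * h).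
Proof.
have [a ha] := max_ideal_power T m1; have [b hb] := max_ideal_power T m2.
exact: (koszul1_vanish hJ (regular2X _ _ hJ hreg) ha hb).
Qed.

Lemma depth1_torsion T g : (forall j, J ('X_j ^+ T * g)) -> J g.
Proof.
move=> hg; have [r1 _] := regular2X (n * T).+1 0 hJ hreg; apply: r1.
have [a ->] := max_ideal_power T m1; rewrite mulr_suml; apply: (ideal_sum _ hJ) => j _.
by rewrite -mulrA; apply: (idealMr _ hJ).
Qed.

Lemma mcoeffXM_lt (h : S) j T (m : 'X_{1..n}) : (m j < T)%N -> ('X_j ^+ T * h)@_m = 0.
Proof.
move=> lt; apply: memN_msupp_eq0; rewrite mulrC mpolyXn (perm_mem (msuppMX _ _)).
apply/mapP => -[m' _ e]; move: lt; rewrite e mnmDE mulmnE mnm1E eqxx mul1n.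
by rewrite ltnNge leq_addr.
Qed.

(** The section that is x^m / x_j^T at j and 0 elsewhere extends to some h. As x_j^T h has no term
    x^m, this monomial occurs in x^m - x_j^T h, an element of the monomial ideal J. *)
Lemma depth2_no_line j T (m : 'X_{1..n}) : (m j < T)%N ->
  (forall i, i != j -> U (U_(i) *+ T + m)%MM) -> U m.
Proof.
move=> lt hi; apply: contrapT => nU.
have [|h hh] := @depth2_section T (fun i => if i == j then 'X_[m] else 0).
  move=> a b; case: (eqVneq b j) => [->|bj]; case: (eqVneq a j) => [->|aj];
    rewrite ?mulr0 ?subr0 ?subrr ?sub0r; try exact: (ideal0 hJ).
    by rewrite mpolyXn -mpolyXD; apply/mspanX/hi.
  by apply: (idealN hJ); rewrite mpolyXn -mpolyXD; apply/mspanX/hi.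
apply: nU; apply: (hh j); rewrite eqxx mcoeff_msupp mcoeffB mcoeffX eqxx.
by rewrite mcoeffXM_lt // subr0 oner_eq0.
Qed.

(** The section that is x^m where [c] holds and 0 elsewhere extends to some h. If both conclusions
    failed, the coefficient of x^m in h would be 1 because of i and 0 because of j. *)
Lemma depth2_connected T (m : 'X_{1..n}) (c : pred 'I_n) i j :
  (forall a b, c a -> ~~ c b -> U (U_(a) *+ T + (U_(b) *+ T + m))%MM) ->
  c i -> ~~ c j -> U (U_(i) *+ T + m)%MM \/ U (U_(j) *+ T + m)%MM.
Proof.
move=> hc ci cj; apply: contrapT => /not_orP[nUi nUj].
have [|h hh] := @depth2_section T (fun l => if c l then 'X_[U_(l) *+ T + m] else 0).
  move=> a b; case: (boolP (c b)) => cb; case: (boolP (c a)) => ca.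
  - rewrite !mpolyXD -!mpolyXn !mulrA ['X_a ^+ T * _]mulrC subrr; exact: (ideal0 hJ).
  - rewrite mulr0 subr0 mpolyXn -mpolyXD addmC -addmA [(m + _)%MM]addmC.
    by apply/mspanX/hc.
  - rewrite mulr0 sub0r mpolyXn -mpolyXD; apply: (idealN hJ).
    rewrite addmC -addmA [(m + _)%MM]addmC; by apply/mspanX/hc.
  - by rewrite !mulr0 subrr; apply: (ideal0 hJ).
have coef l : ('X_l ^+ T * h)@_(U_(l) *+ T + m) = h@_m.
  by rewrite mpolyXn mulrC addmC [(m + _)%MM]addmC mcoeffMX.
have /eqP h1 : h@_m == 1.
  apply: contrapT => ne; apply: nUi; apply: (hh i); rewrite ci mcoeff_msupp mcoeffB mcoeffX eqxx.
  by rewrite coef subr_eq0 eq_sym; apply/negP.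
apply: nUj; apply: (hh j); rewrite (negbTE cj) mcoeff_msupp mcoeffB mcoeff0 sub0r coef.
by rewrite h1 oppr_eq0 oner_eq0.
Qed.

End DepthConsequences.

Lemma mnmUDE n (i l : 'I_n) T (m : 'X_{1..n}) :
  (U_(i) *+ T + m)%MM l = ((l == i) * T + m l)%N.
Proof. by rewrite mnmDE mulmnE mnm1E eq_sym. Qed.

(** * Graph conditions forced by depth *)

Section SquareGraph.
Variables (k : fieldType) (n : nat) (Delta : {set {set 'I_n}}).
Hypotheses (hDelta : simplicial_complex Delta)
  (hcard : forall F, F \in facets Delta -> #|F| = 2%N).
Local Notation S := {mpoly k[n]}.
Local Notation J := (mspan (sr2_mon Delta) : set S).

Variables t1 t2 : S.
Hypotheses (m1 : face_prime k finset.set0 t1) (m2 : face_prime k finset.set0 t2)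
  (hreg : regular2 J t1 t2).

Let upJ := @sr2_mon_up n Delta.

Lemma nonface_card3 (G : {set 'I_n}) : (2 < #|G|)%N -> G \notin Delta.
Proof.
rewrite ltnNge; apply: contra => /face_facet[F /hcard <-].
exact: subset_leq_card.
Qed.

(** Let u = x_W. For i != j, x_i^4 x_j^2 u is in I^2 by [hij], so [depth2_no_line] puts x_j^2 u in
    I^2 for every j, and [depth1_torsion] puts u there. *)
Lemma sr2_square4 (W : {set 'I_n}) : #|W| = 4%N ->
  sr2_mon Delta [multinom (i \in W : nat) | i < n].
Proof.
move=> hW; set u := [multinom _ | _ < n].
(* The condition says that m is at least 2 at i and j, and at least the indicator of W elsewhere. If
   {i, j} is a nonface, its square divides m; otherwise two elements p, q of W outside {i, j} give
   the nonfaces {p, i, j} and {q, i, j}. *)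
have hij i j (m : 'X_{1..n}) : i != j -> (forall l, (2 * ((l == i) || (l == j)) + (l \in W) <= 
    m l + ((l \in W) && ((l == i) || (l == j))))%N) -> sr2_mon Delta m.
  move=> ij hm.
  have [hf|hnf] := boolP ([set i; j] \in Delta); last first.
    exists [set i; j], [set i; j]; split=> // l; rewrite !inE; have := hm l.
    by move: (m l) => x; case: (l \in W); case: (_ || _) => /=; clear; lia.
  have /card_gt1P[p [q [hp hq pq]]] : (1 < #|W :\: [set i; j]|)%N.
    have := cardsID [set i; j] W; rewrite hW.
    have := subset_leq_card (finset.subsetIr W [set i; j]).
    rewrite cards2 ij; lia.
  move: hp hq; rewrite !inE !negb_or => /andP[/andP[pi pj] pW] /andP[/andP[qi qj] qW].
  have c3 a : a != i -> a != j -> a |: [set i; j] \notin Delta.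
    by move=> ai aj; apply: nonface_card3; rewrite cardsU1 !inE negb_or ai aj cards2 ij.
  exists (p |: [set i; j]), (q |: [set i; j]); split; [exact: c3 | exact: c3 |].
  move=> l; rewrite !inE; move: (hm l); move: (m l) => x.
  have [lp|lp] := eqVneq l p; have [lq|lq] := eqVneq l q => /=.
  - by rewrite -lp lq eqxx in pq.
  - by rewrite lp pW (negbTE pi) (negbTE pj) /=; clear; lia.
  - by rewrite lq qW (negbTE qi) (negbTE qj) /=; clear; lia.
  - by case: (l \in W); case: (_ || _) => /=; clear; lia.
have h2 j : sr2_mon Delta (U_(j) *+ 2 + u)%MM.
  apply: (depth2_no_line upJ m1 m2 hreg (j := j) (T := 4)).
    by rewrite mnmUDE eqxx mnmE; case: (_ \in _).
  move=> i ij; apply: (hij i j) => // l; rewrite !mnmUDE mnmE.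
  have [li|li] := eqVneq l i; have [lj|lj] := eqVneq l j; case: (l \in W) => //=.
have /mspanX : J 'X_[u]; last by [].
apply: (depth1_torsion upJ m1 hreg (T := 2)) => j; rewrite mpolyXn -mpolyXD.
exact/mspanX.
Qed.

(** Two nonfaces G, G' whose product divides x_W are disjoint. The singletons in W are faces, so G
    and G' have two elements each and cover W; the one containing w is then an edge at w, a
    contradiction. *)
Lemma sr2_no_star (W : {set 'I_n}) w : #|W| = 4%N -> w \in W ->
  ~ (forall v, v \in W -> v != w -> [set w; v] \in Delta).
Proof.
move=> hW wW hadj; have [G [G' [hG hG' hm]]] := sr2_square4 hW.
have subW : G :|: G' \subset W.
  apply/fintype.subsetP => l; rewrite inE; have := hm l; rewrite mnmE.
  by case: (l \in G); case: (l \in G'); case: (l \in W).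
have dis : G :&: G' = finset.set0.
  apply/setP => l; rewrite !inE; have := hm l; rewrite mnmE.
  by case: (l \in G); case: (l \in G'); case: (l \in W).
have hsum := cardsUI G G'; rewrite dis cards0 addn0 in hsum.
have face1 (H : {set 'I_n}) : H \subset W -> H \notin Delta -> (1 < #|H|)%N.
  move=> /fintype.subsetP HW; rewrite ltnNge; apply: contra => c1.
  have [v vW vw] : exists2 v, v \in W & v != w.
    have /card_gt1P[x [y [xW yW xy]]] : (1 < #|W|)%N by rewrite hW.
    have [e|] := eqVneq x w; last by exists x.
    by exists y => //; rewrite -e eq_sym.
  have [->|[x xH]] := set_0Vmem H.
    by apply: hDelta (hadj v vW vw) (finset.sub0set _).
  have -> : H = [set x].
    by apply/eqP; rewrite eq_sym eqEcard finset.sub1set xH cards1.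
  have [-> |xw] := eqVneq x w.
    by apply: hDelta (hadj v vW vw) _; rewrite finset.sub1set !inE eqxx.
  by apply: hDelta (hadj x (HW _ xH) xw) _; rewrite finset.sub1set !inE eqxx orbT.
have [sG sG'] : G \subset W /\ G' \subset W.
  by move: subW; rewrite finset.subUset => /andP.
have cG := face1 _ sG hG; have cG' := face1 _ sG' hG'.
have cle := subset_leq_card subW; rewrite hW hsum in cle.
have eW : G :|: G' = W.
  by apply/eqP; rewrite eqEcard subW hsum hW /=; apply: (leq_add cG cG').
have [d2 d2'] : #|G| = 2%N /\ #|G'| = 2%N.
  by move: cG cG' cle; move: #|G| #|G'| => a b; clear; lia.
have fin (H : {set 'I_n}) : H \subset W -> H \notin Delta -> #|H| = 2%N -> w \in H -> False.
  move=> /fintype.subsetP HW hH c2 wH.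
  have : #|H :\ w| == 1%N by have := cardsD1 w H; rewrite wH c2 => -[->].
  move=> /cards1P[v ev]; have : v \in H :\ w by rewrite ev inE.
  rewrite !inE => /andP[vw vH]; case/negP: hH.
  rewrite -(finset.setD1K wH) ev; exact: hadj (HW _ vH) vw.
have : w \in G :|: G' by rewrite eW.
by rewrite inE => /orP[]; apply: fin.
Qed.

(** [depth2_connected] is applied to x_i x_j, with [c] selecting i and its neighbours. Without a
    common neighbour, an edge {a, b} leaving this set avoids i and j, and {i, a, b}, {j, a, b} are
    nonfaces whose product is x_a^2 x_b^2 x_i x_j. *)
Lemma sr2_diam2 i j : i != j -> [set i] \in Delta -> [set j] \in Delta ->
  [set i; j] \notin Delta -> exists l, [set i; l] \in Delta /\ [set j; l] \in Delta.
Proof.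
move=> ij hi hj hij; apply: contrapT => nocom.
pose u : 'X_{1..n} := (U_(i) + U_(j))%MM.
pose c l := [set i; l] \in Delta.
(* Both nonfaces would have to contain y, because {x} is a face, but the exponent of y is 1. *)
have notin x y : x != y -> [set x] \in Delta -> ~ sr2_mon Delta (U_(x) *+ 2 + (U_(x) + U_(y)))%MM.
  move=> xy /face_facet[F hF]; rewrite finset.sub1set => xF [G [G' [hG hG' hm]]].
  have onlyy (H : {set 'I_n}) : H \notin Delta ->
      (forall l, l \in H -> (U_(x) *+ 2 + (U_(x) + U_(y)))%MM l != 0%N) -> y \in H.
    move=> hH hl; have /subsetPn[l lH lF] := nonfaceP H hDelta hH F hF.
    have lx : (l == x) = false by apply: contraNF lF => /eqP ->.
    have := hl l lH; rewrite mnmUDE mnmDE !mnm1E [x == l]eq_sym lx.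
    by case: (eqVneq y l) => [->|].
  have yG : y \in G by apply: onlyy => // l lG; rewrite -lt0n; apply: leq_trans (hm l); rewrite lG.
  have yG' : y \in G'.
    by apply: onlyy => // l lG; rewrite -lt0n; apply: leq_trans (hm l); rewrite lG addn1.
  by have := hm y; rewrite yG yG' mnmUDE mnmDE !mnm1E eqxx eq_sym (negbTE xy).
have ci : c i by rewrite /c finset.setUid.
have cj : ~~ c j by [].
have [] := @depth2_connected _ _ _ upJ _ _ m1 m2 hreg 2 u c i j _ ci cj.
- move=> a b ca cb.
  have ab : a != b by apply: contraNneq cb => <-.
  have [hab|hab] := boolP ([set a; b] \in Delta); last first.
    exists [set a; b], [set a; b]; split=> // l.
    rewrite !inE !mnmUDE /u mnmDE !mnm1E ![_ == l]eq_sym.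
    by case: (eqVneq l a) => la; case: (eqVneq l b) => lb //=; clear; lia.
  have ia : i != a by apply: contraNneq cb => e; rewrite /c e.
  have ib : i != b by apply: contraNneq cb => <-.
  have ja : j != a by apply: contraTneq ca => <-.
  have jb : j != b.
    by apply/eqP => e; apply: nocom; exists a; split=> //; rewrite e finset.setUC.
  have c3 x : x != a -> x != b -> x |: [set a; b] \notin Delta.
    by move=> xa xb; apply: nonface_card3; rewrite cardsU1 !inE negb_or xa xb cards2 ab.
  exists (i |: [set a; b]), (j |: [set a; b]); split; [exact: c3 | exact: c3 |].
  move=> l; rewrite !inE !mnmUDE /u mnmDE !mnm1E ![_ == l]eq_sym.
  by case: (eqVneq l a) => la; case: (eqVneq l b) => lb; case: (eqVneq l i) => li;
    case: (eqVneq l j) => lj //=; clear; lia.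
- exact: notin.
- by rewrite [u]addmC; apply: notin; rewrite // eq_sym.
Qed.

End SquareGraph.

(** * Graphs of maximal degree 2 and diameter at most 2 *)

Definition path_edges (l : nat) : seq (nat * nat) := [seq (i, i.+1) | i <- iota 0 l].

Definition cycle_edges (l : nat) : seq (nat * nat) := (0, l.-1)%N :: path_edges l.-1.

Section Graphs.
Variables (n : nat) (Delta : {set {set 'I_n}}).

(** A common form for paths and cycles. Here [l] counts vertices, whereas [is_path] counts edges,
    whence the successor in [is_pathP]. *)
Definition spans (l : nat) (E : seq (nat * nat)) (v : nat -> 'I_n) : Prop :=
  (forall i j, (i < l)%N -> (j < l)%N -> v i = v j -> i = j) /\
  forall F, F \in facets Delta <-> exists2 e, e \in E & F = [set v e.1; v e.2]%SET.

Lemma path_edgesP l (v : nat -> 'I_n) (F : {set 'I_n}) :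
  reflect (exists2 e, e \in path_edges l & F = [set v e.1; v e.2]%SET)
    (F \in [set [set v i; v i.+1] | i : 'I_l]%SET).
Proof.
apply: (iffP imsetP) => [[i _ ->]|[_ /mapP[i il ->] ->]].
  exists (i : nat, i.+1) => //; apply/mapP; exists (i : nat) => //.
  by rewrite mem_iota /= add0n ltn_ord.
by rewrite mem_iota in il; exists (Ordinal il).
Qed.

Lemma is_pathP l : is_path l Delta <-> exists v, spans l.+1 (path_edges l) v.
Proof.
split=> [[v inj e]|[v [inj hF]]]; exists v => //.
  split=> [|F]; first exact: inj.
  by rewrite e; split=> /path_edgesP.
by apply/setP => F; apply/idP/idP => [/hF/path_edgesP //|/path_edgesP/hF].
Qed.

Lemma is_cycleP l : is_cycle l Delta <-> exists v, spans l (cycle_edges l) v.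
Proof.
split=> [[v inj e]|[v [inj hF]]]; exists v => //.
  split=> // F; rewrite e finset.in_setU1; split=> [/orP[/eqP ->|/path_edgesP[x xE ->]]|[x]].
  - by exists (0, l.-1)%N; rewrite ?mem_head.
  - by exists x; rewrite // inE xE orbT.
  - rewrite inE => /orP[/eqP -> ->|xE ->]; first by rewrite eqxx.
    by apply/orP; right; apply/path_edgesP; exists x.
apply/setP => F; rewrite finset.in_setU1; apply/idP/idP => [/hF|]; first case=> x.
  rewrite inE => /orP[/eqP -> ->|xE ->]; first by rewrite eqxx.
  by apply/orP; right; apply/path_edgesP; exists x.
case/orP=> [/eqP ->|/path_edgesP[x xE ->]]; apply/hF.
  by exists (0, l.-1)%N; rewrite ?mem_head.
by exists x; rewrite // inE xE orbT.
Qed.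

Hypotheses (hDelta : simplicial_complex Delta)
  (hex : exists F, F \in facets Delta)
  (hcard : forall F, F \in facets Delta -> #|F| = 2%N).

Definition adj x y := (x != y) && ([set x; y]%SET \in Delta).

Lemma adjC x y : adj x y = adj y x.
Proof. by rewrite /adj eq_sym finset.setUC. Qed.

Lemma adj_neq x y : adj x y -> x != y. Proof. by case/andP. Qed.

Lemma adj_facet x y : adj x y -> [set x; y]%SET \in facets Delta.
Proof.
move=> /andP[xy /face_facet[F hF sub]].
suff -> : [set x; y]%SET = F by [].
by apply/eqP; rewrite eqEcard sub hcard // cards2 xy.
Qed.

Lemma facet_adj F : F \in facets Delta -> exists x y, adj x y /\ F = [set x; y]%SET.
Proof.
move=> hF; have /cards2P[x [y [xy eF]]] : #|F| == 2%N by rewrite hcard.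
by exists x, y; rewrite /adj xy -eF facet_face.
Qed.

Hypothesis deg2 : forall w x y z, adj w x -> adj w y -> adj w z ->
  x != y -> z = x \/ z = y.
Hypothesis diam2 : forall x y x' y', adj x x' -> adj y y' -> x != y ->
  adj x y \/ exists l, adj x l /\ adj y l.

(** The listed vertices are closed under adjacency. By [diam2] every vertex of an edge is within
    distance 2 of the first listed one, so the list contains all of them. *)
Lemma spans_intro (s : seq 'I_n) E a0 : uniq s -> (0 < size s)%N ->
  (forall e, e \in E -> adj (nth a0 s e.1) (nth a0 s e.2)) ->
  (forall i y, (i < size s)%N -> adj (nth a0 s i) y ->
     exists2 j, (j < size s)%N && (((i, j) \in E) || ((j, i) \in E)) & y = nth a0 s j) ->
  (exists y, adj (nth a0 s 0) y) ->
  spans (size s) E (nth a0 s).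
Proof.
move=> us s0 hE hN [b' hb].
have closed x y : x \in s -> adj x y -> y \in s.
  move=> /(nthP a0)[i il <-] /(hN _ _ il)[j /andP[jl _] ->]; exact: mem_nth.
have all_in x y : adj x y -> x \in s.
  move=> xy; have h0 : nth a0 s 0 \in s by apply: mem_nth.
  have [-> //|ne] := eqVneq x (nth a0 s 0).
  have [|[l [xl hl]]] := diam2 xy hb ne; first by rewrite adjC => /(closed _ _ h0).
  by move: xl; rewrite adjC => /closed; apply; apply: closed hl.
split=> [i j il jl /eqP|F]; first by rewrite nth_uniq // => /eqP.
split=> [/facet_adj[x [y [xy ->]]]|[e /hE/adj_facet h ->] //].
have /(nthP a0)[i il ei] := all_in x y xy.
have [j /andP[jl /orP[] hij] ->] := hN i y il (etrans (congr1 (adj^~ y) ei) xy).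
  by exists (i, j) => //=; rewrite ei.
by exists (j, i) => //=; rewrite ei finset.setUC.
Qed.

(** A walk d, a, b, c is grown around a vertex b with two neighbours; the cases differ by where it
    stops or closes up. *)
Lemma graph_classification :
  [\/ is_path 1 Delta, is_path 2 Delta
    | [\/ is_cycle 3 Delta, is_cycle 4 Delta | is_cycle 5 Delta]].
Proof.
have [F hF] := hex; have [p [q [pq _]]] := facet_adj hF.
have ne x y : adj x y -> (x == y) = false by move=> /adj_neq/negbTE.
have sym x y : adj x y -> adj y x by rewrite adjC.
have [[b [a [c [ba bc ac]]]]|no2] :=
    pselect (exists b a c, [/\ adj b a, adj b c & a != c]); last first.
  have one x y z : adj x y -> adj x z -> z = y.
    move=> xy xz; apply/eqP; apply: contrapT => /negP zy; apply: no2.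
    by exists x, z, y.
  apply: Or31; apply/is_pathP; exists (nth p [:: p; q]).
  apply: (@spans_intro [:: p; q]) => //=.
  - by rewrite inE ne.
  - by move=> e; rewrite inE => /eqP -> /=.
  - case=> [|[|//]] y _ /= hy; first by exists 1%N; rewrite // (one _ _ _ pq hy).
    by exists 0%N; rewrite // (one _ _ _ (sym _ _ pq) hy).
  - by exists q.
have Nb x : adj b x -> x = a \/ x = c by move=> bx; apply: deg2 ba bc bx ac.
have ab := sym _ _ ba; have cb := sym _ _ bc.
have [hac|nac] := boolP (adj a c).
  apply: Or33; apply: Or31; apply/is_cycleP; exists (nth a [:: a; b; c]).
  have ca := sym _ _ hac.
  apply: (@spans_intro [:: a; b; c]) => //=.
  - by rewrite !inE !ne.
  - by move=> e; rewrite !inE => /or3P[] /eqP -> /=.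
  - case=> [|[|[|//]]] y _ /= hy.
    + by case: (deg2 ab hac hy (adj_neq bc)) => ->; [exists 1%N | exists 2%N].
    + by case: (Nb _ hy) => ->; [exists 0%N | exists 2%N].
    + by case: (deg2 ca cb hy (adj_neq ab)) => ->; [exists 0%N | exists 1%N].
  - by exists b.
have acF : (a == c) = false by apply/negbTE.
have [[d [had db]]|noa] := pselect (exists d, adj a d /\ d != b); last first.
  have Na y : adj a y -> y = b.
    by move=> ay; apply/eqP; apply: contrapT => /negP yb; apply: noa; exists y.
  apply: Or32; apply/is_pathP; exists (nth a [:: a; b; c]).
  apply: (@spans_intro [:: a; b; c]) => //=.
  - by rewrite !inE acF !ne.
  - by move=> e; rewrite !inE => /orP[] /eqP -> /=.
  - case=> [|[|[|//]]] y _ /= hy.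
    + by exists 1%N; rewrite // (Na _ hy).
    + by case: (Nb _ hy) => ->; [exists 0%N | exists 2%N].
    (* A neighbour y != b of c would be within distance 2 of a. As b is the only neighbour of a, y
       would be adjacent to b, hence equal to a or c. *)
    + exists 1%N => //; have [//|yb] := eqVneq y b.
      have ya : a != y by apply: contraNneq nac => ->; apply: sym.
      have [/Na e|[l [/Na -> /sym/Nb [e|e]]]] := diam2 ab (sym _ _ hy) ya.
      * by rewrite e eqxx in yb.
      * by rewrite e eqxx in ya.
      * by move: (ne _ _ hy); rewrite e eqxx.
  - by exists b.
have bd : b != d by rewrite eq_sym.
have Na x : adj a x -> x = b \/ x = d by move=> ax; apply: deg2 ab had ax bd.
have da := sym _ _ had.
have dc : d != c by apply: contraNneq nac => <-.
have [hcd|ncd] := boolP (adj c d).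
  have hdc := sym _ _ hcd.
  apply: Or33; apply: Or32; apply/is_cycleP; exists (nth a [:: a; b; c; d]).
  apply: (@spans_intro [:: a; b; c; d]) => //=.
  - by rewrite !inE acF (negbTE bd) !ne.
  - by move=> e; rewrite !inE => /or4P[] /eqP -> /=.
  - case=> [|[|[|[|//]]]] y _ /= hy.
    + by case: (Na _ hy) => ->; [exists 1%N | exists 3%N].
    + by case: (Nb _ hy) => ->; [exists 0%N | exists 2%N].
    + by case: (deg2 cb hcd hy bd) => ->; [exists 1%N | exists 3%N].
    + by case: (deg2 da hdc hy ac) => ->; [exists 0%N | exists 2%N].
  - by exists b.
(* The ends d and c of the walk are not adjacent, so they have a common neighbour, which closes a
   pentagon. *)
have [e [hde hce]] : exists e, adj d e /\ adj c e.
  have [dc'|[l [dl cl]]] := diam2 da cb dc; first by rewrite adjC dc' in ncd.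
  by exists l.
have ea : e != a by apply: contraNneq nac => <-; apply: sym.
have eb : b != e.
  apply: contraTneq hde => <-; apply/negP => db'.
  case: (Nb d (sym _ _ db')) => eq; last by rewrite eq eqxx in dc.
  by move: (ne _ _ had); rewrite eq eqxx.
apply: Or33; apply: Or33; apply/is_cycleP; exists (nth a [:: a; b; c; e; d]).
have hed := sym _ _ hde; have hec := sym _ _ hce.
apply: (@spans_intro [:: a; b; c; e; d]) => //=.
- rewrite !inE acF (negbTE bd) (negbTE eb) [a == e]eq_sym (negbTE ea).
  by rewrite [c == d]eq_sym (negbTE dc) !ne.
- by move=> x; rewrite !inE => /orP[/eqP -> //|/or4P[] /eqP -> /=].
- case=> [|[|[|[|[|//]]]]] y _ /= hy.
  + by case: (Na _ hy) => ->; [exists 1%N | exists 4%N].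
  + by case: (Nb _ hy) => ->; [exists 0%N | exists 2%N].
  + by case: (deg2 cb hce hy eb) => ->; [exists 1%N | exists 3%N].
  + have cd : c != d by rewrite eq_sym.
    by case: (deg2 hec hed hy cd) => ->; [exists 2%N | exists 4%N].
  + by case: (deg2 da hde hy _) => [|->|->]; [rewrite eq_sym | exists 0%N | exists 3%N].
- by exists b.
Qed.

End Graphs.

Section CohenMacaulayGraph.
Variables (k : fieldType) (n : nat) (Delta : {set {set 'I_n}}).
Hypotheses (hDelta : simplicial_complex Delta)
  (hex : exists F, F \in facets Delta)
  (hcard : forall F, F \in facets Delta -> #|F| = 2%N).
Local Notation J := (mspan (sr2_mon Delta) : set {mpoly k[n]}).

Lemma sr2_cm_graph : cohen_macaulay_quo J ->
  [\/ is_path 1 Delta, is_path 2 Delta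
    | [\/ is_cycle 3 Delta, is_cycle 4 Delta | is_cycle 5 Delta]].
Proof.
move=> [d [[[s [sm sreg sd]] _] [_ hd]]].
(* A chain of three primes makes the dimension, hence the length of the regular sequence, at least
   2. *)
have [P hP] := sr2_chain k hDelta hex hcard; have := hd _ _ hP; rewrite -sd => s2.
have hreg := regular_seq_regular2 (@sr2_ideal k n Delta) sreg s2.
rewrite graded_max_idealE in sm.
have m1 : face_prime k finset.set0 s`_0 by apply/sm/mem_nth/ltnW.
have m2 : face_prime k finset.set0 s`_1 by apply/sm/mem_nth.
apply: graph_classification => // [w x y z wx wy wz xy|x y x' y' xx' yy' xy].
  apply: contrapT => /not_orP[/eqP zx /eqP zy].
  apply: (@sr2_no_star k n Delta hDelta hcard _ _ m1 m2 hreg (w |: (x |: [set y; z]))%SET w).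
  - move: (adj_neq wx) (adj_neq wy) (adj_neq wz) => nx ny nz.
    rewrite !cardsU1 cards1 !inE !negb_or xy nx ny nz.
    by rewrite [x == z]eq_sym [y == z]eq_sym zx zy.
  - by rewrite !inE eqxx.
  - move=> v; rewrite !inE => /or4P[] /eqP -> vw; first by rewrite eqxx in vw.
    + by case/andP: wx.
    + by case/andP: wy.
    + by case/andP: wz.
have vert a b : adj Delta a b -> [set a]%SET \in Delta.
  by move=> /andP[_ h]; apply: hDelta h _; rewrite finset.sub1set !inE eqxx.
have [hxy|hxy] := boolP ([set x; y]%SET \in Delta); first by left; rewrite /adj xy.
right; have [l [h1 h2]] := sr2_diam2 hDelta hcard m1 m2 hreg xy (vert _ _ xx') (vert _ _ yy') hxy.
exists l; rewrite /adj h1 h2 !andbT; split; apply: contraNneq hxy => e.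
  by rewrite e finset.setUC.
by rewrite e.
Qed.

End CohenMacaulayGraph.

(** * Clean filtrations from ordered cone decompositions *)

Section ConeFiltration.
Variables (k : fieldType) (n : nat).
Local Notation S := {mpoly k[n]}.
Implicit Types (U V : 'X_{1..n} -> Prop) (F : {set 'I_n}) (Fs : seq {set 'I_n}).

(** The monomials of u k[x_i : i in F], where q = (u, F). *)
Definition in_cone (q : 'X_{1..n} * {set 'I_n}) (m : 'X_{1..n}) : Prop :=
  forall i, if i \in q.2 then (q.1 i <= m i)%N else m i == q.1 i.

(** [Fs] lists the sets F of the successive primes P_F, from the ideal upwards. *)
Definition filtered U Fs : Prop :=
  exists I : nat -> set S,
    prime_filtration (mspan U) (size Fs) I (fun i => face_prime k (nth finset.set0 Fs i)).

Lemma filtered_nil : filtered (fun _ => True) [::].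
Proof.
exists (fun _ => setT).
have e : mspan (fun _ => True) = [set: S]%classic by apply/seteqP; split.
split=> //.
by move=> i _; rewrite -e; apply: mspan_monomial.
Qed.

(** The quotient V / U is generated by x^u. A multiple of x^u by a variable outside F stays in V but
    leaves the cone, so it is in U; multiples by monomials in the variables of F stay in the cone.
    The annihilator is thus P_F. *)
Lemma filtered_cons U V u F Fs : upclosed U -> upclosed V ->
  (forall m, V m <-> U m \/ in_cone (u, F) m) -> (forall m, in_cone (u, F) m -> ~ U m) ->
  filtered V Fs -> filtered U (F :: Fs).
Proof.
move=> upU upV hV hU [I [I0 Ir hmon hstep]].
exists (fun i => if i is j.+1 then I j else mspan U); split=> //=.
  by case=> [_|i]; [apply: mspan_monomial | apply: hmon].
case=> [_|i il] /=; last exact: hstep.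
rewrite I0; have UV m : U m -> V m by move=> h; apply/hV; left.
have Vu : V u by apply/hV; right=> i /=; case: ifP.
split; [exact: mspanS | exact/mspan_monomial/face_prime_up | exact: face_prime_prime |].
have hJU := @mspan_ideal k n U upU; have hJV := @mspan_ideal k n V upV.
apply: (quotient_iso_cyclic (u := 'X_[u])) => //.
- exact: face_prime_ideal.
- exact: mspanS.
- exact/mspanX.
- move=> a Va; suff [c hc] : ideal_plus (mspan U) 'X_[u] a by exists c; rewrite mulrC.
  apply: mspan_min Va; first exact: ideal_plus_ideal.
  move=> m /hV[Um|cm]; first by exists 0; rewrite mulr0 subr0; apply/mspanX.
  exists 'X_[m - u]; rewrite -mpolyXD addmC submK ?subrr; first exact: ideal0 hJU.
  by apply/mnm_lepP => i; have := cm i; case: ifP => [//|_ /eqP ->].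
- move=> c; rewrite mspanMX.
  suff h (m : 'X_{1..n}) : U (u + m)%MM <-> exists2 j, j \notin F & m j != 0%N.
    by rewrite (eq_mspan k h).
  split=> [Um|[j jF mj]].
    apply: contrapT => no; apply: (hU (u + m)%MM) => // i /=; rewrite mnmDE.
    case: ifPn => [_|iF]; first exact: leq_addr.
    have -> : m i = 0%N by apply/eqP; apply: contrapT => /negP mi; apply: no; exists i.
    by rewrite addn0.
  have /hV[//|/(_ j)] : V (u + m)%MM by rewrite addmC; apply: upV.
  by rewrite /= (negbTE jF) mnmDE -[X in _ == X]addn0 eqn_add2l (negbTE mj).
Qed.

(** f is the index of the cone containing a monomial, values from [size cones] on meaning none.
    Monotonicity of f under multiplication makes each set f >= t an ideal; these ideals shrink as t
    grows, hence the reversal of the list. *)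
Lemma filtered_cones V Fs (f : 'X_{1..n} -> nat) cones : upclosed V ->
  (forall m d, V m -> (f (d + m)%MM < size cones)%N -> (f m <= f (d + m)%MM)%N) ->
  (forall t m, (t < size cones)%N ->
     (V m /\ f m = t <-> in_cone (nth (0%MM, finset.set0) cones t) m)) ->
  filtered V Fs ->
  filtered (fun m => V m /\ (size cones <= f m)%N) (rev (map snd cones) ++ Fs).
Proof.
move=> upV hf hc hV.
have up t : (t <= size cones)%N -> upclosed (fun m => V m /\ (t <= f m)%N).
  move=> ts d m [Vm tm]; split; first exact: upV.
  have [lt|] := ltnP (f (d + m)%MM) (size cones); last exact: leq_trans.
  exact: leq_trans tm (hf _ _ Vm lt).
suff h t : (t <= size cones)%N ->
    filtered (fun m => V m /\ (t <= f m)%N) (rev (take t (map snd cones)) ++ Fs).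
  by have := h _ (leqnn _); rewrite -(size_map snd) take_size.
elim: t => [_|t IH ts].
  rewrite take0 /=; case: hV => I hI; exists I.
  by rewrite (@eq_mspan k _ _ V) // => m; split=> // -[].
rewrite (take_nth finset.set0) ?size_map // rev_rcons cat_cons.
have et : nth finset.set0 (map snd cones) t = (nth (0%MM, finset.set0) cones t).2.
  by rewrite (nth_map (0%MM, finset.set0)).
apply: (filtered_cons (u := (nth (0%MM, finset.set0) cones t).1) _ _ _ _ (IH (ltnW ts))).
- exact: up.
- exact/up/ltnW.
- move=> m; rewrite et -surjective_pairing -hc //; split.
    move=> [Vm]; rewrite leq_eqVlt => /orP[/eqP <-|lt]; [by right | by left].
  by move=> [[Vm lt]|[Vm <-]]; split=> //; apply: ltnW.
- by move=> m; rewrite et -surjective_pairing -hc // => -[Vm <-] [_]; rewrite ltnn.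
Qed.

End ConeFiltration.

(** * Computable certificates for cone decompositions *)

Section Certificates.
Implicit Types (c u g : seq nat) (e : nat * nat).
Implicit Types (q : seq nat * (nat * nat)) (L : seq (seq nat * (nat * nat))).

Definition on_edge e (i : nat) : bool := (i == e.1) || (i == e.2).

Variables (l : nat) (E : seq (nat * nat)).

(* The pair [(u, (a, b))] stands for the cone u k[x_a, x_b]. *)
Definition cone_test c q : bool :=
  all (fun i => if on_edge q.2 i then (nth 0 q.1 i <= nth 0 c i)%N
                else nth 0%N c i == nth 0%N q.1 i) (iota 0 l).

(* The value [size L] means that no cone of L contains c. *)
Definition cone_index L c : nat := find (cone_test c) L.

(* Vectors of length [l] with entries at most 3: the cones are generated in
   entries at most 2, so truncating the entries at 3 loses no information. *)
Fixpoint box (d : nat) : seq (seq nat) :=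
  if d is d'.+1 then [seq a :: c | a <- iota 0 4, c <- box d'] else [:: [::]].

Definition incr_trunc c i : seq nat := set_nth 0%N c i (minn 3 (nth 0%N c i).+1).

(** The second check makes every initial union of cones closed under divisors; the third makes the
    cones pairwise disjoint. *)
Definition cones_ok L : bool :=
  [&& all (fun q => [&& q.2 \in E, size q.1 == l & all (fun a => (a <= 2)%N) q.1]) L,
      all (fun c => all (fun i => (cone_index L c <= cone_index L (incr_trunc c i))%N) (iota 0 l))
        (box l)
    & all (fun c => all (fun t => cone_test c (nth ([::], (0, 0)%N) L t) ==> (cone_index L c == t))
                        (iota 0 (size L))) (box l)].

Definition covers c g g' : bool :=
  all (fun i => ((i \in g) + (i \in g') <= nth 0 c i)%N) (iota 0 l).

(* [gens] are the generators of I in the vertices of Delta; among the monomials in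
   these vertices the cones of [L1] (of [L2]) cover those outside I (outside I^2). *)
Definition complement_ok (L1 L2 : seq (seq nat * (nat * nat))) (gens : seq (seq nat)) : bool :=
  [&& all (fun g => all (fun i => (i < l)%N) g &&
                    all (fun e => has (fun i => ~~ on_edge e i) g) E) gens,
      all (fun c => (size L2 <= cone_index L2 c)%N ==>
         has (fun g => has (fun g' => covers c g g') gens) gens) (box l),
      all (fun c => (size L1 <= cone_index L1 c)%N ==> has (fun g => covers c g [::]) gens) (box l),
      all (fun c => (cone_index L1 c < size L1)%N ==> (cone_index L2 c < size L2)%N) (box l)
    & [&& all (fun q => all (fun i => all (fun j =>
              [|| on_edge q.2 i, on_edge q.2 j | ~~ covers q.1 [:: i] [:: j]])
            (iota 0 l)) (iota 0 l)) L2,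
          all (fun q => all (fun i => on_edge q.2 i || (nth 0%N q.1 i == 0%N)) (iota 0 l)) L1,
          all (fun e => (e.1 < l)%N && (e.2 < l)%N) E
        & all (fun e => e \in map snd L2) E]].

Lemma mem_box d c : size c = d -> all (fun a => (a <= 3)%N) c -> c \in box d.
Proof.
elim: d c => [|d IH] [|a c] // [sc] /andP[a3 hc].
apply/allpairsP; exists (a, c); split=> //=; last exact: IH.
by rewrite !inE; case: a a3 => [|[|[|[|]]]].
Qed.

Definition trunc c : seq nat := map (minn 3) c.

Lemma trunc_box c : size c = l -> trunc c \in box l.
Proof.
move=> sc; apply: mem_box; first by rewrite size_map.
by apply/allP => _ /mapP[a _ ->]; apply: geq_minl.
Qed.

Lemma cone_test_trunc c q : size c = l -> size q.1 = l -> all (fun a => (a <= 2)%N) q.1 ->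
  cone_test (trunc c) q = cone_test c q.
Proof.
move=> sc sq /allP hq; apply: eq_in_all => i; rewrite mem_iota add0n => /= il.
have := hq _ (mem_nth 0%N (_ : i < size q.1)%N); rewrite sq => /(_ il) /=.
rewrite (nth_map 0%N) ?sc //; move: (nth 0%N q.1 i) (nth 0%N c i) => x y h.
by case: ifP => _; [rewrite leq_min; clear -h; lia | apply/eqP/eqP; clear -h; lia].
Qed.

Lemma cone_index_trunc L c : cones_ok L -> size c = l ->
  cone_index L (trunc c) = cone_index L c.
Proof.
move=> /and3P[/allP hL _ _] sc; apply: eq_in_find => q /hL/and3P[_ /eqP sq hq].
exact: cone_test_trunc.
Qed.

Lemma cone_index_eq L c t : cones_ok L -> size c = l -> (t < size L)%N ->
  (cone_index L c == t) = cone_test c (nth ([::], (0, 0)%N) L t).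
Proof.
move=> /[dup] ok /and3P[/allP hL _ /allP hd] sc tL.
have /and3P[_ /eqP sq hq] := hL _ (mem_nth ([::], (0, 0)%N) tL).
apply/eqP/idP => [ec|ct].
  rewrite -[in nth _ _ t]ec; apply: (nth_find _ (a := cone_test c)); rewrite has_find.
  by move: ec; rewrite /cone_index => ->.
have /allP/(_ t) := hd _ (trunc_box sc); rewrite mem_iota add0n tL => /(_ isT).
by rewrite cone_test_trunc // ct cone_index_trunc // => /eqP.
Qed.

Lemma cone_index_incr L c i : cones_ok L -> size c = l -> (i < l)%N ->
  (cone_index L c <= cone_index L (set_nth 0 c i (nth 0 c i).+1))%N.
Proof.
move=> /[dup] ok /and3P[_ /allP hm _] sc il.
have /allP/(_ i) := hm _ (trunc_box sc); rewrite mem_iota add0n il => /(_ isT).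
rewrite cone_index_trunc //; congr (_ <= _)%N.
rewrite -(cone_index_trunc ok (c := set_nth _ _ _ _)); last first.
  by rewrite size_set_nth sc; apply/maxn_idPr.
congr (cone_index L _); rewrite /incr_trunc /trunc; apply: (@eq_from_nth _ 0%N).
  by rewrite size_set_nth !size_map size_set_nth.
move=> j; rewrite size_set_nth size_map sc (maxn_idPr il) => jl.
rewrite nth_set_nth /= !(nth_map 0%N) ?size_set_nth ?sc ?(maxn_idPr il) //.
by rewrite nth_set_nth /=; case: eqP => // _; lia.
Qed.

(** * From certificates to the ideal of the complex *)

Section Transport.
Variables (k : fieldType) (n : nat) (Delta : {set {set 'I_n}}).
Hypothesis hDelta : simplicial_complex Delta.
Variable v : nat -> 'I_n.
Hypothesis hv : spans Delta l E v.
Variables (L1 L2 : seq (seq nat * (nat * nat))) (gens : seq (seq nat)).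
Hypotheses (ok1 : cones_ok L1) (ok2 : cones_ok L2) (okc : complement_ok L1 L2 gens).
Implicit Types (m d : 'X_{1..n}).

Definition core : {set 'I_n} := [set v i | i : 'I_l]%SET.
Definition vec m : seq nat := [seq m (v i) | i <- iota 0 l].
(** The total degree in the variables that are not vertices of Delta; all of them lie in I. *)
Definition ext m : nat := (\sum_(i in ~: core) m i)%N.
(** The inverse of v, with the value l outside [core]. *)
Definition pos (i : 'I_n) : nat := find (fun j => v j == i) (iota 0 l).

Lemma size_vec m : size (vec m) = l.
Proof. by rewrite size_map size_iota. Qed.

Lemma nth_vec m i : (i < l)%N -> nth 0%N (vec m) i = m (v i).
Proof. by move=> il; rewrite (nth_map 0%N) ?size_iota // nth_iota. Qed.

Lemma mem_core i : (i < l)%N -> v i \in core.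
Proof. by move=> il; apply/imsetP; exists (Ordinal il). Qed.

Lemma coreP i : i \in core -> exists2 j, (j < l)%N & i = v j.
Proof. by case/imsetP => j _ ->; exists j. Qed.

Lemma pos_v j : (j < l)%N -> pos (v j) = j.
Proof.
move=> jl; have [inj _] := hv.
have h : has (fun x => v x == v j) (iota 0 l).
  by apply/hasP; exists j; rewrite // mem_iota add0n jl.
have := nth_find 0%N h; rewrite -/(pos (v j)).
have pl : (pos (v j) < l)%N by rewrite -[l in (_ < l)%N](size_iota 0) -has_find.
by rewrite nth_iota // add0n => /eqP /inj ->.
Qed.

Lemma pos_out i : i \notin core -> pos i = l.
Proof.
move=> iC; rewrite /pos -[RHS](size_iota 0); apply: hasNfind; apply/hasPn => j.
by rewrite mem_iota add0n /= => jl; apply: contraNneq iC => <-; apply: mem_core.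
Qed.

Lemma extD d m : ext (d + m)%MM = (ext d + ext m)%N.
Proof. by rewrite /ext -big_split; apply: eq_bigr => i _; rewrite mnmDE. Qed.

Lemma ext0P m : reflect (forall i, i \notin core -> m i = 0%N) (ext m == 0%N).
Proof.
rewrite /ext sum_nat_eq0; apply: (iffP forall_inP) => h i.
  by move=> iC; apply/eqP/h; rewrite inE.
by rewrite inE => /h/eqP.
Qed.

Lemma ext1P y m : y \notin core ->
  reflect (forall i, i \notin core -> m i = (i == y)) ((m y == 1%N) && (ext m == 1%N)).
Proof.
move=> yC; have yC' : y \in ~: core by rewrite inE.
rewrite /ext (bigD1 y) //=; apply: (iffP andP).
  move=> [/eqP my]; rewrite my -[X in _ == X]addn0 eqn_add2l sum_nat_eq0 => /forall_inP h i iC.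
  have [->//|iy] := eqVneq i y.
  by apply/eqP; apply: (h i); rewrite inE iC.
move=> h; rewrite h // eqxx big1 // => i /andP[]; rewrite inE => /h -> /negbTE -> //.
Qed.

(** The monomial d is multiplied in one variable at a time; a variable outside [core] does not
    change the vector. *)
Lemma index_mono L m d : cones_ok L -> (cone_index L (vec m) <= cone_index L (vec (d + m)%MM))%N.
Proof.
move=> okL; have step i m' : (cone_index L (vec m') <= cone_index L (vec (U_(i) + m')%MM))%N.
  have [/coreP[j jl ->]|iC] := boolP (i \in core).
    have -> : vec (U_(v j) + m')%MM = set_nth 0%N (vec m') j (nth 0%N (vec m') j).+1.
      apply: (@eq_from_nth _ 0%N) => [|a].
        by rewrite size_set_nth !size_vec; symmetry; apply/maxn_idPr.
      rewrite size_vec => al; rewrite nth_set_nth /= !nth_vec // mnmDE mnm1E.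
      have [->|aj] := eqVneq a j; first by rewrite eqxx.
      by case: eqP => // /(hv.1 _ _ jl al) e; rewrite e eqxx in aj.
    by apply: cone_index_incr; rewrite ?size_vec.
  suff -> : vec (U_(i) + m')%MM = vec m' by [].
  apply/eq_in_map => a; rewrite mem_iota add0n /= => al; rewrite mnmDE mnm1E.
  by case: eqP iC => // ->; rewrite mem_core.
rewrite [d]multinomUE_id; elim/big_rec: _ => [|i x _ IH]; first by rewrite add0m.
rewrite -addmA; apply: (leq_trans IH); elim: (d i) => [|e IHe]; first by rewrite mulm0n add0m.
by rewrite mulmS -addmA; apply: leq_trans IHe (step _ _).
Qed.

Definition edge_set e : {set 'I_n} := [set v e.1; v e.2]%SET.

Lemma edge_lt e : e \in E -> (e.1 < l)%N && (e.2 < l)%N.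
Proof. by case/and5P: okc => _ _ _ _ /and4P[_ _ /allP h _]; apply: h. Qed.

Lemma mem_edge_set e j : e \in E -> (j < l)%N -> (v j \in edge_set e) = on_edge e j.
Proof.
move=> /edge_lt/andP[e1 e2] jl; rewrite !inE /on_edge.
by congr (_ || _); apply/eqP/eqP => [/(hv.1 _ _ jl) -> // | -> //].
Qed.

Lemma edge_set_core e i : e \in E -> i \in edge_set e -> i \in core.
Proof. by move=> /edge_lt/andP[e1 e2]; rewrite !inE => /orP[] /eqP ->; apply: mem_core. Qed.

Lemma edge_set_facet e : e \in E -> edge_set e \in facets Delta.
Proof. by move=> eE; apply/hv.2; exists e. Qed.

(** Outside [core], [pos] points past the end of a vector of length l, so the default 0 leaves the
    exponent of z alone. *)
Definition lift_mon u (z : 'X_{1..n}) : 'X_{1..n} := (z + [multinom nth 0%N u (pos i) | i < n])%MM.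

Definition lift_cone (z : 'X_{1..n}) q : 'X_{1..n} * {set 'I_n} := (lift_mon q.1 z, edge_set q.2).

Lemma lift_coneP L (z : 'X_{1..n}) m t : cones_ok L -> (forall i, i \in core -> z i = 0%N) ->
  (t < size L)%N ->
  in_cone (nth (0%MM, finset.set0) (map (lift_cone z) L) t) m <->
  cone_index L (vec m) = t /\ forall i, i \notin core -> m i = z i.
Proof.
move=> /[dup] okL /and3P[/allP hL _ _] hz tL; rewrite (nth_map ([::], (0, 0)%N)) //.
set q := nth _ L t.
have /and3P[qE /eqP sq _] : [&& q.2 \in E, size q.1 == l & all (fun a => (a <= 2)%N) q.1].
  exact/hL/mem_nth.
rewrite (rwP eqP) cone_index_eq ?size_vec // -/q.
have liftE i : lift_mon q.1 z i = (z i + nth 0%N q.1 (pos i))%N by rewrite mnmDE mnmE.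
split=> [hm|[/allP ct hm] i].
  split=> [|i iC].
    apply/allP => j; rewrite mem_iota add0n /= => jl; rewrite nth_vec //.
    by have := hm (v j); rewrite /= mem_edge_set // liftE pos_v // hz ?mem_core.
  have := hm i; rewrite /= ifN; last by apply: contra iC; apply: edge_set_core.
  by rewrite liftE pos_out // nth_default ?sq // addn0 => /eqP.
have [/coreP[j jl ->]|iC] := boolP (i \in core).
  rewrite /= mem_edge_set // liftE pos_v // hz ?mem_core //.
  by have := ct j; rewrite mem_iota add0n jl nth_vec // => /(_ isT).
rewrite /= ifN; last by apply: contra iC; apply: edge_set_core.
by rewrite liftE pos_out // nth_default ?sq // addn0 hm.
Qed.

(** [rank2] indexes the cones of L2 in the variables of [core]; [rank1] y indexes y times the cones
    of L1. The sizes of the lists stand for monomials in none of these cones. *)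
Definition rank2 m : nat := if ext m == 0%N then cone_index L2 (vec m) else size L2.
Definition rank1 (y : 'I_n) m : nat :=
  if (m y == 1%N) && (ext m == 1%N) then cone_index L1 (vec m) else size L1.

Definition outside (ys : seq 'I_n) m : Prop :=
  (size L2 <= rank2 m)%N /\ forall y, y \in ys -> (size L1 <= rank1 y m)%N.

Lemma rank2_mono m d : (rank2 (d + m)%MM < size L2)%N -> (rank2 m <= rank2 (d + m)%MM)%N.
Proof.
rewrite /rank2 extD addn_eq0; case: (ext d == 0%N) => /=; last by rewrite ltnn.
by case: (ext m == 0%N) => /=; [move=> _; apply: index_mono | rewrite ltnn].
Qed.

(** A divisor of y w, with w in a cone of L1, either keeps the factor y or is a divisor of w. The
    second case is excluded: by the certificate w lies in a cone of L2, hence so does each of its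
    divisors. *)
Lemma rank1_mono y m d : y \notin core -> (size L2 <= rank2 m)%N ->
  (rank1 y (d + m)%MM < size L1)%N -> (rank1 y m <= rank1 y (d + m)%MM)%N.
Proof.
move=> yC hm; rewrite /rank1; case: (ext1P (d + m)%MM yC) => [hdm lt|_]; last by rewrite ltnn.
have mono := index_mono m d ok1; case: (ext1P m yC) => // hno.
case: (boolP (ext m == 0%N)) => e0.
  move: hm; rewrite /rank2 e0 leqNgt; case/negP.
  have /and5P[_ _ _ /allP h _] := okc.
  have sv := size_vec m.
  have /implyP := h _ (trunc_box sv); rewrite !cone_index_trunc //; apply.
  exact: leq_ltn_trans mono lt.
case: hno => i iC; have := hdm i iC; rewrite mnmDE.
have [->|iy] := eqVneq i y; last by move/eqP; rewrite addn_eq0 => /andP[_ /eqP].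
move=> hy; suff : m y != 0%N by move: (m y) (d y) hy => a b; clear; lia.
apply: contraNneq e0 => my; apply/ext0P => j jC; have := hdm j jC; rewrite mnmDE.
by have [->|_] := eqVneq j y; [rewrite my | move/eqP; rewrite addn_eq0 => /andP[_ /eqP]].
Qed.

Lemma outside_up ys : (forall y, y \in ys -> y \notin core) -> upclosed (outside ys).
Proof.
move=> hys d m [h2 h1]; split.
  rewrite leqNgt; apply/negP => /[dup] lt /rank2_mono/(leq_trans h2); by rewrite leqNgt lt.
move=> y yys; rewrite leqNgt; apply/negP => /[dup] lt /(rank1_mono (hys _ yys) h2).
by move/(leq_trans (h1 _ yys)); rewrite leqNgt lt.
Qed.

(** The cones of L2 filter the quotient for empty [ys], and already use every facet. Each new y then
    removes y times the cones of L1. *)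
Lemma filtered_outside ys : uniq ys -> (forall y, y \in ys -> y \notin core) ->
  exists2 Fs, (forall F, F \in Fs <-> F \in facets Delta) & filtered k (outside ys) Fs.
Proof.
have inE2 L q : cones_ok L -> q \in L -> edge_set q.2 \in facets Delta.
  by move=> /and3P[/allP h _ _] /h/and3P[qE _ _]; apply: edge_set_facet.
elim: ys => [_ _|y ys IH /andP[yys uys] hys].
  exists (rev (map snd (map (lift_cone 0%MM) L2)) ++ [::]).
    move=> F; rewrite cats0 mem_rev -map_comp; split=> [/mapP[q qL ->]|/hv.2[e eE ->]].
      exact: inE2 qL.
    have /and5P[_ _ _ _ /and4P[_ _ _ /allP/(_ e eE)/mapP[q qL ->]]] := okc.
    by apply/mapP; exists q.
  have := @filtered_cones k n (fun _ => True) [::] rank2 (map (lift_cone 0%MM) L2).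
  rewrite size_map => /(_ _ _ _ (@filtered_nil k n)) h.
  suff : filtered k (fun m => True /\ (size L2 <= rank2 m)%N)
      (rev (map snd (map (lift_cone 0%MM) L2)) ++ [::]).
    by move=> [I]; rewrite (@eq_mspan k _ _ (outside [::])) => [hI|m]; [exists I | split=> [[]|[]]].
  apply: h => // [m d _|t m tL]; first exact: rank2_mono.
  rewrite lift_coneP // => [|i _]; last by rewrite mnm0E.
  rewrite /rank2; split=> [[_]|[et hm]].
    case: ext0P => [h <-|_ e]; last by rewrite -e ltnn in tL.
    by split=> // i iC; rewrite h // mnm0E.
  by split=> //; case: ext0P => // -[] i iC; rewrite hm // mnm0E.
have [Fs hFs fil] := IH uys (fun z zys => hys z (mem_behead (s := y :: ys) zys)).
have yC : y \notin core by apply: hys; rewrite mem_head.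
exists (rev (map snd (map (lift_cone U_(y)) L1)) ++ Fs).
  move=> F; rewrite mem_cat mem_rev -map_comp; split=> [/orP[/mapP[q qL ->]|/hFs //]|/hFs ->].
    exact: inE2 qL.
  by rewrite orbT.
have upo : upclosed (outside ys).
  by apply: outside_up => z zys; apply: hys; rewrite inE zys orbT.
have := @filtered_cones k n (outside ys) Fs (rank1 y) (map (lift_cone U_(y)) L1) upo.
rewrite size_map => h.
suff : filtered k (fun m => outside ys m /\ (size L1 <= rank1 y m)%N)
    (rev (map snd (map (lift_cone U_(y)) L1)) ++ Fs).
  move=> [I]; rewrite (@eq_mspan k _ _ (outside (y :: ys))) => [hI|m]; first by exists I.
  split=> [[[h2 h1] hy]|[h2 h1]].
    by split=> // z; rewrite inE => /orP[/eqP ->|/h1].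
  by split; [split=> // z zys; apply: h1; rewrite inE zys orbT | apply: h1; rewrite mem_head].
apply: h => // [m d [h2 _]|t m tL]; first exact: rank1_mono.
rewrite lift_coneP // => [|i iC]; last by rewrite mnm1E; case: eqP yC => // ->; rewrite iC.
split=> [[_]|[et hm]].
  rewrite /rank1; case: (ext1P _ yC) => [h' <-|_ e]; last by rewrite -e ltnn in tL.
  by split=> // i iC; rewrite h' // mnm1E eq_sym.
have hm' i : i \notin core -> m i = (i == y) by move=> iC; rewrite hm // mnm1E eq_sym.
have e1 : (m y == 1%N) && (ext m == 1%N) by apply/ext1P.
split; last by rewrite /rank1 e1.
split; first by rewrite /rank2; case/andP: e1 => _ /eqP ->.
move=> z zys; have zy : z != y by apply: contraNneq yys => <-.
by rewrite /rank1 hm' ?(negbTE zy) //; apply: hys; rewrite inE zys orbT.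
Qed.

Lemma nonface_gen g : g \in gens -> [set i | pos i \in g]%SET \notin Delta /\
  forall i, i \notin core -> pos i \notin g.
Proof.
move=> gg; have /and5P[/allP h _ _ _ _] := okc; have /andP[/allP gl /allP gE] := h _ gg.
split; last by move=> i iC; rewrite pos_out //; apply/negP => /gl; rewrite ltnn.
apply/(nonfaceP _ hDelta) => F /hv.2[e eE ->]; have /hasP[j jg je] := gE _ eE.
have jl := gl _ jg; apply/subsetPn; exists (v j); first by rewrite inE pos_v.
by rewrite -/(edge_set e) mem_edge_set.
Qed.

Lemma nonface_extra y : y \notin core -> [set y]%SET \notin Delta.
Proof.
move=> yC; apply/(nonfaceP _ hDelta) => F /hv.2[e eE ->]; rewrite finset.sub1set.
by apply: contra yC; apply: edge_set_core.
Qed.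

Lemma covers_trunc m g g' i : covers (trunc (vec m)) g g' -> (i < l)%N ->
  ((i \in g) + (i \in g') <= m (v i))%N.
Proof.
move=> /allP/(_ i); rewrite mem_iota add0n => h il.
apply: leq_trans (h il) _; rewrite (nth_map 0%N) ?size_vec // nth_vec //.
exact: geq_minr.
Qed.

(** By degree in the variables outside [core]: in degree 0 two generators of I divide m, in degree 1
    one generator and y, in higher degree y^2 or y y'. *)
Lemma outside_sr2 m : outside (enum (~: core)) m -> sr2_mon Delta m.
Proof.
have /and5P[_ /allP c2 /allP c1 _ _] := okc.
have bm := trunc_box (size_vec m).
move=> [h2 h1]; case: (posnP (ext m)) => [e0|].
  move: h2; rewrite /rank2 e0 eqxx => h2; have := c2 _ bm.
  rewrite cone_index_trunc ?size_vec // h2 => /hasP[g gg /hasP[g' gg' cv]].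
  have [nG oG] := nonface_gen gg; have [nG' oG'] := nonface_gen gg'.
  exists [set i | pos i \in g]%SET, [set i | pos i \in g']%SET; split=> // i.
  rewrite !inE; have [/coreP[j jl ->]|iC] := boolP (i \in core).
    by rewrite pos_v //; apply: covers_trunc.
  by rewrite (negbTE (oG _ iC)) (negbTE (oG' _ iC)).
rewrite lt0n => /negP nz.
have [y yC my] : exists2 y, y \notin core & m y != 0%N.
  apply: contrapT => no; apply: nz; apply/ext0P => i iC.
  by apply/eqP; apply: contrapT => /negP mi; apply: no; exists i.
have [one|none] := boolP ((m y == 1%N) && (ext m == 1%N)).
  have := h1 y; rewrite mem_enum inE => /(_ yC); rewrite /rank1 one => h1y.
  have := c1 _ bm; rewrite cone_index_trunc ?size_vec // h1y => /hasP[g gg cv].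
  have [nG oG] := nonface_gen gg.
  exists [set i | pos i \in g]%SET, [set y]%SET; split=> //; first exact: nonface_extra.
  move=> i; rewrite !inE; have [/coreP[j jl ->]|iC] := boolP (i \in core).
    rewrite pos_v //; have := covers_trunc cv jl; rewrite addn0.
    by case: eqP yC => [<-|]; rewrite ?mem_core ?addn0.
  by rewrite (negbTE (oG _ iC)) add0n (ext1P _ yC one).
have [my2|my2] := ltnP 1 (m y).
  exists [set y]%SET, [set y]%SET; split; try exact: nonface_extra.
  by move=> i; rewrite !inE; case: eqP => // ->.
have my1 : m y = 1%N by apply/eqP; rewrite eqn_leq my2 lt0n.
have [y' y'C [yy' my']] : exists2 y', y' \notin core & y' != y /\ m y' != 0%N.
  apply: contrapT => no; case/negP: none; apply/ext1P => // i iC.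
  have [->|iy] := eqVneq i y; first by rewrite my1.
  by apply/eqP; apply: contrapT => /negP mi; apply: no; exists i.
exists [set y]%SET, [set y']%SET; split; try exact: nonface_extra.
move=> i; rewrite !inE; have [->|iy] := eqVneq i y.
  by rewrite eq_sym (negbTE yy') my1.
by case: eqP => // ->; rewrite lt0n.
Qed.

(** In a cone, exponents off the edge are those of its generator, while every nonface has an element
    off the edge. For L2 this gives a product x_j x_j' off the edge dividing the generator, which
    the certificate excludes. For y times L1 the generator has no variable off the edge, so both
    nonfaces contain y, whose exponent is 1. *)
Lemma sr2_outside m : sr2_mon Delta m -> outside (enum (~: core)) m.
Proof.
move=> [G [G' [hG hG' hm]]].
have /and5P[_ _ _ _ /and4P[/allP s2 /allP s1 _ _]] := okc.
have hnf (H : {set 'I_n}) : H \notin Delta ->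
    forall e, e \in E -> exists2 i, i \in H & i \notin edge_set e.
  by move=> hH e eE; apply/subsetPn; apply: (nonfaceP H hDelta hH); apply: edge_set_facet.
split.
  rewrite /rank2; case: ext0P => // h0; rewrite leqNgt -has_find; apply/hasP => -[q qL ct].
  have /and3P[/allP hL _ _] := ok2; have /and3P[qE _ _] := hL _ qL.
  have loc (H : {set 'I_n}) : H \notin Delta -> (forall i, i \in H -> m i != 0%N) ->
      exists2 j, (j < l)%N & (v j \in H) && ~~ on_edge q.2 j.
    move=> hH hmH; have [i iH ie] := hnf H hH _ qE.
    have /coreP[j jl ei] : i \in core by apply: contraNT (hmH _ iH) => /h0 ->.
    by exists j; rewrite // -ei iH -mem_edge_set // -ei.
  have [i iG|j jl /andP[jG jo]] := loc G hG.
    by rewrite -lt0n; apply: leq_trans (hm i); rewrite iG.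
  have [i iG|j' jl' /andP[jG' jo']] := loc G' hG'.
    by rewrite -lt0n; apply: leq_trans (hm i); rewrite iG addn1.
  have /allP/(_ j) := s2 _ qL; rewrite mem_iota add0n jl => /(_ isT)/allP/(_ j').
  rewrite mem_iota add0n jl' (negbTE jo) (negbTE jo') => /(_ isT) /=.
  case/negP; apply/allP => i; rewrite mem_iota add0n /= => il; rewrite !inE.
  have := allP ct i; rewrite mem_iota add0n il nth_vec // => /(_ isT) cti.
  move: cti; case: ifP => [io _|_ /eqP <-].
    have -> : (i == j) = false by case: eqP io jo => // -> ->.
    by have -> : (i == j') = false by case: eqP io jo' => // -> ->.
  apply: leq_trans (hm (v i)); apply: leq_add.
    by case: eqP => // ->; rewrite jG.
  by case: eqP => // ->; rewrite jG'.
move=> y; rewrite mem_enum inE => yC; rewrite /rank1; case: (ext1P _ yC) => // h0.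
rewrite leqNgt -has_find; apply/hasP => -[q qL ct].
have /and3P[/allP hL _ _] := ok1; have /and3P[qE _ _] := hL _ qL.
have loc (H : {set 'I_n}) : H \notin Delta -> (forall i, i \in H -> m i != 0%N) -> y \in H.
  move=> hH hmH; have [i iH ie] := hnf H hH _ qE.
  have [/coreP[j jl ei]|iC] := boolP (i \in core); last first.
    by have := hmH _ iH; rewrite h0 // eqb0 negbK => /eqP <-.
  have := allP ct j; rewrite mem_iota add0n jl nth_vec // -mem_edge_set // -ei.
  rewrite (negbTE ie) => /(_ isT)/eqP e; have := hmH _ iH; rewrite e.
  have /allP/(_ j) := s1 _ qL; rewrite mem_iota add0n jl -mem_edge_set // -ei (negbTE ie).
  by move=> /(_ isT) /= ->.
have yG : y \in G.
  by apply: loc hG _ => i iG; rewrite -lt0n; apply: leq_trans (hm i); rewrite iG.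
have yG' : y \in G'.
  by apply: loc hG' _ => i iG; rewrite -lt0n; apply: leq_trans (hm i); rewrite iG addn1.
by have := hm y; rewrite yG yG' h0 // eqxx.
Qed.

Lemma certificate_clean : clean_quo (mspan (sr2_mon Delta) : set {mpoly k[n]}).
Proof.
have [|y|Fs hFs [I hI]] := @filtered_outside (enum (~: core)); first exact: enum_uniq.
  by rewrite mem_enum inE.
rewrite (@eq_mspan k _ _ (sr2_mon Delta)) in hI; last first.
  by move=> m; split; [exact: outside_sr2 | exact: sr2_outside].
exists (size Fs), I, (fun i => face_prime k (nth finset.set0 Fs i)); split=> //.
rewrite sr2_minimal_primes //; apply/seteqP; split=> [_ [i /= il <-]|_ [F /hFs hF ->]].
  by exists (nth finset.set0 Fs i) => //; apply/hFs/mem_nth.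
by exists (index F Fs); rewrite /= ?index_mem ?nth_index.
Qed.

End Transport.
End Certificates.

(** * Explicit decompositions for the five graphs *)

Section CleanGraphs.
Variables (k : fieldType) (n : nat) (Delta : {set {set 'I_n}}).
Hypothesis hDelta : simplicial_complex Delta.
Local Open Scope nat_scope.
Local Notation clean_sr2 := (clean_quo (mspan (sr2_mon Delta) : set {mpoly k[n]})).

(* The cones of S/I ([cones1]) and of S/I^2 ([cones2]), for the vertices of Delta only;
   their orders come from a backtracking search. *)
Definition path1_cones1 : seq (seq nat * (nat * nat)) :=
  [:: ([:: 0; 0], (0, 1))].

Definition path1_cones2 : seq (seq nat * (nat * nat)) :=
  [:: ([:: 0; 0], (0, 1))].

(** All subsets of a single edge are faces, so there are no generators among the vertices. *)
Lemma clean_path1 : is_path 1 Delta -> clean_sr2.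
Proof.
move=> /is_pathP[v hv].
by apply: (certificate_clean k hDelta hv
  (L1 := path1_cones1) (L2 := path1_cones2) (gens := [::])); vm_compute.
Qed.

Definition path2_cones1 : seq (seq nat * (nat * nat)) :=
  [:: ([:: 0; 0; 0], (0, 1)); ([:: 0; 0; 1], (1, 2))].

Definition path2_cones2 : seq (seq nat * (nat * nat)) :=
  [:: ([:: 0; 0; 0], (0, 1)); ([:: 0; 0; 1], (0, 1)); ([:: 0; 0; 2], (1, 2));
      ([:: 1; 0; 2], (1, 2))].

Lemma clean_path2 : is_path 2 Delta -> clean_sr2.
Proof.
move=> /is_pathP[v hv].
by apply: (certificate_clean k hDelta hv
  (L1 := path2_cones1) (L2 := path2_cones2) (gens := [:: [:: 0; 2]])); vm_compute.
Qed.

Definition cycle3_cones1 : seq (seq nat * (nat * nat)) :=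
  [:: ([:: 0; 0; 0], (0, 2)); ([:: 0; 1; 0], (0, 1)); ([:: 0; 1; 1], (1, 2))].

Definition cycle3_cones2 : seq (seq nat * (nat * nat)) :=
  [:: ([:: 0; 0; 0], (0, 2)); ([:: 0; 1; 0], (0, 2)); ([:: 0; 2; 0], (0, 1));
      ([:: 0; 2; 1], (0, 1)); ([:: 0; 2; 2], (1, 2)); ([:: 1; 2; 2], (1, 2))].

Lemma clean_cycle3 : is_cycle 3 Delta -> clean_sr2.
Proof.
move=> /is_cycleP[v hv].
by apply: (certificate_clean k hDelta hv
  (L1 := cycle3_cones1) (L2 := cycle3_cones2) (gens := [:: [:: 0; 1; 2]])); vm_compute.
Qed.

Definition cycle4_cones1 : seq (seq nat * (nat * nat)) :=
  [:: ([:: 0; 0; 0; 0], (0, 3)); ([:: 0; 0; 1; 0], (2, 3)); ([:: 0; 1; 0; 0], (0, 1));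
      ([:: 0; 1; 1; 0], (1, 2))].

Definition cycle4_cones2 : seq (seq nat * (nat * nat)) :=
  [:: ([:: 0; 0; 0; 0], (0, 3)); ([:: 0; 0; 1; 0], (0, 3)); ([:: 0; 1; 0; 0], (0, 3));
      ([:: 0; 0; 2; 0], (2, 3)); ([:: 0; 1; 1; 0], (2, 3)); ([:: 0; 2; 0; 0], (0, 1));
      ([:: 0; 2; 0; 1], (0, 1)); ([:: 0; 2; 1; 0], (1, 2)); ([:: 1; 0; 2; 0], (2, 3));
      ([:: 1; 1; 1; 0], (0, 1)); ([:: 0; 2; 1; 1], (1, 2)); ([:: 1; 1; 2; 0], (1, 2))].

Lemma clean_cycle4 : is_cycle 4 Delta -> clean_sr2.
Proof.
move=> /is_cycleP[v hv].
by apply: (certificate_clean k hDelta hv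
  (L1 := cycle4_cones1) (L2 := cycle4_cones2) (gens := [:: [:: 0; 2]; [:: 1; 3]])); vm_compute.
Qed.

Definition cycle5_cones1 : seq (seq nat * (nat * nat)) :=
  [:: ([:: 0; 0; 0; 0; 0], (0, 4)); ([:: 0; 0; 0; 1; 0], (3, 4)); ([:: 0; 0; 1; 0; 0], (2, 3));
      ([:: 0; 1; 0; 0; 0], (0, 1)); ([:: 0; 1; 1; 0; 0], (1, 2))].

(** Each edge occurs four times: in the five variables, I^2 agrees locally with the square of the
    prime of an edge, of colength 1 + 3. *)
Definition cycle5_cones2 : seq (seq nat * (nat * nat)) :=
  [:: ([:: 0; 0; 0; 0; 0], (0, 4)); ([:: 0; 0; 0; 1; 0], (0, 4)); ([:: 0; 0; 1; 0; 0], (0, 4));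
      ([:: 0; 1; 0; 0; 0], (0, 4)); ([:: 0; 0; 0; 2; 0], (3, 4)); ([:: 0; 0; 1; 1; 0], (3, 4));
      ([:: 0; 0; 2; 0; 0], (2, 3)); ([:: 0; 1; 0; 1; 0], (3, 4)); ([:: 0; 1; 1; 0; 0], (2, 3));
      ([:: 0; 2; 0; 0; 0], (0, 1)); ([:: 0; 0; 2; 0; 1], (2, 3)); ([:: 0; 2; 0; 0; 1], (0, 1));
      ([:: 0; 2; 1; 0; 0], (1, 2)); ([:: 0; 1; 1; 0; 1], (1, 2)); ([:: 0; 2; 0; 1; 0], (1, 2));
      ([:: 1; 0; 0; 2; 0], (3, 4)); ([:: 1; 1; 0; 1; 0], (0, 1)); ([:: 1; 1; 1; 0; 0], (0, 1));
      ([:: 1; 0; 2; 0; 0], (1, 2)); ([:: 1; 0; 1; 1; 0], (2, 3))].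

Lemma clean_cycle5 : is_cycle 5 Delta -> clean_sr2.
Proof.
move=> /is_cycleP[v hv].
by apply: (certificate_clean k hDelta hv
  (L1 := cycle5_cones1) (L2 := cycle5_cones2)
  (gens := [:: [:: 0; 2]; [:: 1; 3]; [:: 2; 4]; [:: 3; 0]; [:: 4; 1]])); vm_compute.
Qed.

End CleanGraphs.

Theorem corollary3p2 (k : fieldType) (n : nat) (Delta : {set {set 'I_n}})
    (hDelta : simplicial_complex Delta) (hpure : pure Delta)
    (hdim : complex_dim Delta = 1%R) :
  let I := stanley_reisner k Delta in
  let I2 := ideal_mul I I in
  (clean_quo I2 <-> cohen_macaulay_quo I2) /\
  (cohen_macaulay_quo I2 <->
     [\/ is_path 1 Delta, is_path 2 Delta
       | [\/ is_cycle 3 Delta, is_cycle 4 Delta | is_cycle 5 Delta]]).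
Proof.
move=> I I2; rewrite /I2 /I sr_square.
have [hex hcard] := facets_card2 hpure hdim.
have ab := @sr2_clean_cm k n Delta hDelta hex hcard.
have bc := @sr2_cm_graph k n Delta hDelta hex hcard.
suff ca : [\/ is_path 1 Delta, is_path 2 Delta
    | [\/ is_cycle 3 Delta, is_cycle 4 Delta | is_cycle 5 Delta]] ->
    clean_quo (mspan (sr2_mon Delta) : set {mpoly k[n]}).
  by split; split; auto.
case=> [h|h|[h|h|h]].
- exact: (clean_path1 k hDelta h).
- exact: (clean_path2 k hDelta h).
- exact: (clean_cycle3 k hDelta h).
- exact: (clean_cycle4 k hDelta h).
- exact: (clean_cycle5 k hDelta h).
Qed.
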